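(* Let $n\ge 7$. If $G$ and $H$ are graphs on $n$ vertices with the same $(n-3)$-deck, i.e. $\mathcal{D}_{n-3}(G)=\mathcal{D}_{n-3}(H)$, then $G$ is connected if and only if $H$ is connected. (Thus connectedness is $3$-reconstructible for $n$-vertex graphs when $n\ge7$.) Moreover, the threshold on $n$ is sharp: there exist two graphs on $6$ vertices with the same $3$-deck such that one is connected and the other is not.
   Context: All graphs are finite and simple. For a graph $G$, a $k$-card of $G$ is an induced subgraph of $G$ on $k$ vertices, considered up to isomorphism. The $k$-deck $\mathcal{D}_k(G)$ is the multiset of all $k$-cards of $G$ (one for each $k$-element vertex subset). A graph invariant or property is called $l$-reconstructible (for $n$-vertex graphs) if it is determined by the $(n-l)$-deck, i.e. any two $n$-vertex graphs with the same $(n-l)$-deck agree on it. *)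

(* Defs.v *)
From mathcomp Require Import all_boot.
Set Implicit Arguments. Unset Strict Implicit. Unset Printing Implicit Defensive.

Definition simple_graph (n : nat) (G : rel 'I_n) : Prop :=
  irreflexive G /\ symmetric G.

Definition induced_iso (n k : nat) (G : rel 'I_n) (F : rel 'I_k)
    (S : {set 'I_n}) : bool :=
  [exists f : {ffun 'I_k -> 'I_n},
     [&& injectiveb f, f @: setT == S &
         [forall i, forall j, F i j == G (f i) (f j)]]].

Definition deck_mult (n k : nat) (G : rel 'I_n) (F : rel 'I_k) : nat :=
  #|[set S : {set 'I_n} | (#|S| == k) && induced_iso G F S]|.

(* Equality of k-decks (as multisets of isomorphism classes of k-cards). *)
Definition same_deck (n k : nat) (G H : rel 'I_n) : Prop :=
  forall F : rel 'I_k, simple_graph F -> deck_mult G F = deck_mult H F.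

Definition connected_graph (n : nat) (G : rel 'I_n) : Prop :=
  forall x y : 'I_n, connect G x y.

(* Main.v *)
Require Import Defs.
From mathcomp Require Import all_boot all_order all_algebra.
From mathcomp Require Import zify ring lra.
Set Implicit Arguments. Unset Strict Implicit. Unset Printing Implicit Defensive.
Import Order.TTheory GRing.Theory Num.Theory.

(** Suppose G is connected, H is disconnected, and they have the same (n-3)-deck. Every vertex
    of G lies in a connected card, so G and hence H has two connected cards; therefore H has
    either an isolated vertex or exactly two components, one of which is a single edge.

    Counting the pairs (vertex, card) in which the vertex has degree e in the card shows that
    the numbers of vertices of degree i in G and in H differ by (-1)^i C(n-1, i) q(i) for some
    polynomial q of degree at most 2. These differences are too large for an isolated vertex of
    H to exist, except when n = 7; there G must be K4 with three pendant edges, and the number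
    of cards consisting of a triangle and an isolated vertex distinguishes G from H.

    In the remaining case the same relation shows that G and H have the same degrees, and
    comparing the numbers of edges of connected cards shows that G has exactly two leaves. The
    count of induced paths on three vertices by the degree of their first vertex obeys a
    similar quadratic relation. The value at leaves differs, so the quadratic does not vanish
    and G has a vertex of degree n-3 or n-4. Then G has at least n-1 connected cards, whereas H
    has at most n-2. *)

(** * Cards up to isomorphism *)

(** A vertex of degree [i] has degree between [i - 3] and [i] in any card containing it, so each
    moment involves only four consecutive counts. This gives n - 3 linear equations for the n
    counts, and the quadratic is the freedom that remains. Its strength comes from the factor C(n-1,
    i), which exceeds n at middle degrees: counts are at most n, so the quadratic must be tiny
    there. For small n the binomials are too small for this, and linear integer arithmetic takes
    over. At n = 7 even that does not suffice: the degree sequences 4,4,4,3,1,1,1 and 5,3,3,3,2,2,0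
    satisfy every equation, which is why a second invariant of the cards is needed.

    The exact number of leaves serves twice. It makes the path counts of G and H differ at leaves,
    and at n = 7 it excludes the graphs with edges wa, wc, wd, ar, rs, st and possibly cd, which
    have only five connected cards. *)

Definition card_iso (V W : finType) (g : rel V) (h : rel W)
    (S : {set V}) (T : {set W}) :=
  exists f : V -> W, [/\ {in S &, injective f}, f @: S = T &
                        {in S &, forall x y, g x y = h (f x) (f y)}].

Section DeckSum.
Variables (n k : nat).
Implicit Types (G H : rel 'I_n) (S T : {set 'I_n}).

(** Finite functions form a [finType], so [canon] can pick a representative among them. *)
Definition graph_of (F : {ffun 'I_k * 'I_k -> bool}) : rel 'I_k :=
  fun i j => F (i, j).

Lemma induced_isoP G (F : rel 'I_k) S :
  reflect (exists f : 'I_k -> 'I_n,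
             [/\ injective f, f @: setT = S & forall i j, F i j = G (f i) (f j)])
          (induced_iso G F S).
Proof.
apply: (iffP existsP) => [[f /and3P [/injectiveP injf /eqP imf /forallP Ff]]|].
  by exists f; split=> // i j; apply/eqP; move/forallP: (Ff i); apply.
case=> f [injf imf Ff]; exists [ffun i => f i]; apply/and3P; split.
- by apply/injectiveP => i j; rewrite !ffunE; apply: injf.
- by apply/eqP; rewrite -imf; apply: eq_imset => i; rewrite ffunE.
- by apply/forallP=> i; apply/forallP=> j; rewrite !ffunE Ff.
Qed.

Lemma induced_iso_card_iso G H (F : rel 'I_k) S T :
  induced_iso G F S -> induced_iso H F T -> card_iso G H S T.
Proof.
case/induced_isoP=> f [injf <- Ff] /induced_isoP [g [injg <- Fg]].
(* The default value of [r] below needs an index; for [k = 0] both sets are empty and [id]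
   serves. *)
case: k f g injf injg F Ff Fg => [|k'] f g injf injg F Ff Fg.
  exists id; split=> //.
  - by apply/setP=> x; apply/imsetP/imsetP=> [[y /imsetP[[]]]|[[]]].
  - by move=> x y /imsetP[[]].
pose r x := if [pick i | f i == x] is Some i then g i else g ord0.
have rE i : r (f i) = g i.
  rewrite /r; case: pickP => [j /eqP /injf -> //|/(_ i)]; by rewrite eqxx.
exists r; split.
- by move=> _ _ /imsetP[i _ ->] /imsetP[j _ ->]; rewrite !rE => /injg ->.
- by rewrite -imset_comp; apply: eq_imset => i /=; rewrite rE.
- by move=> _ _ /imsetP[i _ ->] /imsetP[j _ ->]; rewrite !rE -Ff -Fg.
Qed.

Lemma card_iso_induced_iso G H (F : rel 'I_k) S T :
  card_iso G H S T -> induced_iso G F S -> induced_iso H F T.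
Proof.
case=> r [injr <- rE] /induced_isoP [f [injf fS Ff]].
have fi i : f i \in S by rewrite -fS imset_f.
apply/induced_isoP; exists (r \o f); split.
- by move=> i j /= /injr e; apply: injf; apply: e.
- by rewrite imset_comp fS.
- by move=> i j /=; rewrite -rE.
Qed.

(** The picked predicate depends only on the isomorphism class of the card, so isomorphic cards of
    different graphs get the same representative. *)
Definition canon G S := [pick F | induced_iso G (graph_of F) S].

Lemma canon_eq G H (F : rel 'I_k) S T :
  induced_iso G F S -> induced_iso H F T -> canon G S = canon H T.
Proof.
move=> GF HF; apply: eq_pick => F' /=; apply/idP/idP => iF'.
- exact: card_iso_induced_iso (induced_iso_card_iso GF HF) iF'.
- exact: card_iso_induced_iso (induced_iso_card_iso HF GF) iF'.
Qed.

Lemma canon_spec G S F : canon G S = Some F -> induced_iso G (graph_of F) S.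
Proof. by rewrite /canon; case: pickP => // F' iF' [<-]. Qed.

Lemma canon_some G S : #|S| = k -> exists F, canon G S = Some F.
Proof.
move=> Sk; rewrite /canon; case: pickP => [F _|noF]; first by exists F.
pose f (i : 'I_k) := enum_val (cast_ord (esym Sk) i).
suff: false by [].
rewrite -(noF [ffun p => G (f p.1) (f p.2)]); apply/induced_isoP; exists f; split.
- by move=> i j /enum_val_inj /cast_ord_inj.
- apply/setP=> x; apply/imsetP/idP => [[i _ ->]|xS]; first exact: enum_valP.
  exists (cast_ord Sk (enum_rank_in xS x)) => //.
  by rewrite /f cast_ordK enum_rankK_in.
- by move=> i j; rewrite /graph_of ffunE.
Qed.

Lemma induced_iso_simple G (F : rel 'I_k) S :
  simple_graph G -> induced_iso G F S -> simple_graph F.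
Proof.
case=> irr sym /induced_isoP [f [_ _ Ff]].
by split=> [i|i j]; rewrite !Ff ?irr // sym.
Qed.

(** Group the cards by their representative: each class has the same size in [G] and [H], and both
    summands are constant on it. Every later use of the deck hypothesis passes through this
    lemma. *)
Lemma deck_sum G H (phi psi : {set 'I_n} -> nat) :
  simple_graph G -> simple_graph H -> same_deck k G H ->
  (forall S T, #|S| = k -> card_iso G H S T -> phi S = psi T) ->
  \sum_(S : {set 'I_n} | #|S| == k) phi S = \sum_(T : {set 'I_n} | #|T| == k) psi T.
Proof.
move=> sG sH GH eqf.
rewrite (partition_big (canon G) predT) //= [RHS](partition_big (canon H) predT) //=.
apply: eq_bigr => -[F|] _; last first.
  rewrite !big1 // => S /andP [/eqP Sk /eqP].
  - by have [F ->] := canon_some H Sk.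
  - by have [F ->] := canon_some G Sk.
pose C X := [set S : {set 'I_n} | (#|S| == k) && (canon X S == Some F)].
have main X0 S0 : simple_graph X0 -> canon X0 S0 = Some F ->
    simple_graph (graph_of F) /\
    forall X, C X = [set S : {set 'I_n} | (#|S| == k) && induced_iso X (graph_of F) S].
  move=> sX0 e0; have i0 := canon_spec e0; split; first exact: induced_iso_simple i0.
  move=> X; apply/setP=> S; rewrite !inE; congr (_ && _); apply/eqP/idP.
    exact: canon_spec.
  by move=> iX; rewrite (canon_eq iX i0).
have toC X f : \sum_(S : {set 'I_n} | (#|S| == k) && (canon X S == Some F)) f S = \sum_(S in C X) f S.
  by apply: eq_bigl => S; rewrite inE.
rewrite !toC.
(* The deck hypothesis speaks of simple [F] only. A representative attained by some card is simple;
   one attained by none gives two empty classes. *)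
have Ceq : #|C G| = #|C H|.
  have [g0|[S]] := set_0Vmem (C G); last first.
    rewrite inE => /andP [_ /eqP e]; have [sF E] := main _ _ sG e.
    by rewrite !E; apply: GH.
  have [h0|[S]] := set_0Vmem (C H); first by rewrite g0 h0.
  rewrite inE => /andP [_ /eqP e]; have [sF E] := main _ _ sH e.
  by rewrite !E; apply: GH.
have agree S T : S \in C G -> T \in C H -> phi S = psi T.
  rewrite !inE => /andP [/eqP Sk /eqP e] /andP [_ /eqP e'].
  by apply: eqf => //; apply: induced_iso_card_iso (canon_spec e) (canon_spec e').
have [h0|[T0 T0C]] := set_0Vmem (C H).
  by move: Ceq; rewrite h0 cards0 => /eqP; rewrite cards_eq0 => /eqP ->; rewrite !big_set0.
have [S0 S0C] : exists S0, S0 \in C G.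
  by apply/set0Pn; rewrite -cards_eq0 Ceq cards_eq0; apply/set0Pn; exists T0.
rewrite (eq_bigr (fun=> psi T0)) => [|S SC]; last exact: agree.
rewrite [RHS](eq_bigr (fun=> psi T0)) => [|T TC]; last first.
  by rewrite -(agree _ _ S0C TC) (agree _ _ S0C T0C).
by rewrite !sum_nat_const Ceq.
Qed.

End DeckSum.

(** * Sequences with equal moments *)

Lemma trinomial_revision L a b : b <= a -> a <= L ->
  'C(L, a) * 'C(a, b) = 'C(L, b) * 'C(L - b, a - b).
Proof.
move=> ba aL; have bL := leq_trans ba aL.
have f1 := bin_fact aL; have f2 := bin_fact ba; have f3 := bin_fact bL.
have f4 := bin_fact (leq_sub2r b aL).
have e : L - b - (a - b) = L - a by lia.
rewrite e in f4.
apply/eqP; rewrite -(eqn_pmul2r (fact_gt0 b)) -(eqn_pmul2r (fact_gt0 (a - b))).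
rewrite -(eqn_pmul2r (fact_gt0 (L - a))); apply/eqP.
transitivity (L`!); first by rewrite -f1 -f2; ring.
by rewrite -f3 -f4; ring.
Qed.

(* If [a i] vertices of a graph on [M + 1] vertices have degree [i], this counts the pairs
   (vertex, card) in which the vertex has degree [e] in the card, cards being obtained by
   deleting three vertices. *)
Definition moment (M : nat) (a : nat -> nat) (e : nat) :=
  \sum_(i < M.+1) a i * ('C(i, e) * 'C(M - i, M - 3 - e)).

(** Deleting three vertices removes at most three neighbours, so only the degrees [e] to [e + 3]
    contribute; outside this range one of the two binomials vanishes. *)
Lemma moment4 M a e : e + 3 <= M ->
  moment M a e = \sum_(t < 4) a (e + t) * ('C(e + t, e) * 'C(M - (e + t), 3 - t)).
Proof.
move=> eM; rewrite /moment.
pose F i := a i * ('C(i, e) * 'C(M - i, M - 3 - e)).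
rewrite -(big_mkord xpredT F) (@big_cat_nat _ _ _ e) //=; last by lia.
rewrite big_nat big1 ?add0n; last by move=> i /andP[_ ie]; rewrite /F bin_small // !mul0n muln0.
rewrite (@big_cat_nat _ _ _ (e + 4)) //=; [|lia|lia].
rewrite [X in _ + X]big_nat [X in _ + X]big1 ?addn0; last first.
  by move=> i /andP[ie iM]; rewrite /F (@bin_small (M - i)) ?muln0 //; lia.
rewrite -{1}[e]add0n big_addn (_ : e + 4 - e = 4) ?big_mkord; last by lia.
apply: eq_bigr => i _; have := ltn_ord i => i4.
rewrite /F addnC; congr (_ * (_ * _)).
rewrite -bin_sub; last by lia.
by congr 'C(_, _); lia.
Qed.

Section Quadratic.
Local Open Scope ring_scope.

(** Trinomial revision, applied twice, turns C(M, e+t) times the weight of [e + t] into C(M, e)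
    C(M-e, 3) C(3, t). Up to a nonzero factor, the difference of the two moments is therefore the
    third difference of [q] at [e]. *)
Lemma third_difference_zero M (a b : nat -> nat) (q : nat -> rat) e :
  (e + 3 <= M)%N -> moment M a e = moment M b e ->
  (forall i, (i <= M)%N -> (a i)%:R - (b i)%:R = (-1) ^+ i * 'C(M, i)%:R * q i) ->
  q (e + 3)%N = 3 * q (e + 2)%N - 3 * q (e + 1)%N + q e.
Proof.
move=> eM; rewrite !moment4 // => ab qE.
have K_gt0 : ('C(M, e) * 'C(M - e, 3) != 0)%N by rewrite -lt0n muln_gt0 !bin_gt0; lia.
have term t : (t <= 3)%N ->
    ('C(M, e + t) * ('C(e + t, e) * 'C(M - (e + t), 3 - t))
     = ('C(M, e) * 'C(M - e, 3)) * 'C(3, t))%N.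
  move=> t3; rewrite mulnA trinomial_revision; [|lia|lia].
  rewrite -[RHS]mulnA trinomial_revision; [|lia|lia].
  by rewrite addKn -mulnA subnDA.
have : \sum_(t < 4) (-1) ^+ (e + t) * q (e + t)%N *
    (('C(M, e) * 'C(M - e, 3)) * 'C(3, t))%N%:R = 0.
  transitivity (\sum_(t < 4) ((a (e + t)%N)%:R - (b (e + t)%N)%:R) *
      ('C(e + t, e) * 'C(M - (e + t), 3 - t))%N%:R : rat).
    apply: eq_bigr => t _; have t4 := ltn_ord t.
    rewrite -term; last by lia.
    rewrite qE ?natrM; last by lia.
    by ring.
  transitivity ((\sum_(t < 4) a (e + t) * ('C(e + t, e) * 'C(M - (e + t), 3 - t)))%N%:R -
    (\sum_(t < 4) b (e + t) * ('C(e + t, e) * 'C(M - (e + t), 3 - t)))%N%:R : rat).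
    by rewrite !natr_sum -sumrB; apply: eq_bigr => t _; rewrite !natrM; ring.
  by rewrite ab subrr.
have K0 : (('C(M, e) * 'C(M - e, 3))%N%:R : rat) != 0 by rewrite pnatr_eq0.
set K := ('C(M, e) * 'C(M - e, 3))%N in K0 *.
rewrite !big_ord_recl big_ord0 /= !exprD /bump /= !addn0 !addn1 /=.
have s0 : (-1) ^+ e != 0 :> rat by rewrite signr_eq0.
rewrite (_ : 'C(3, 0) = 1)%N // (_ : 'C(3, 1) = 3)%N // (_ : 'C(3, 2) = 3)%N // (_ : 'C(3, 3) = 1)%N //.
rewrite !natrM => E; apply/eqP; rewrite -subr_eq0; apply/eqP.
apply: (mulfI K0); apply: (mulfI s0); rewrite !mulr0 -[RHS]oppr0 -E.
rewrite !addnS !addn0 /K natrM !expr0 !expr1 !mulr1 !addr0.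
move: ('C(M, e)%:R) ('C(M - e, 3)%:R) ((-1) ^+ e) (q e) (q e.+1) (q e.+2) (q e.+3).
by move=> *; ring.
Qed.

(* Equal moments make [a - b] orthogonal to all polynomials of degree at most [M - 3] on
   [{0, ..., M}]; the sequences below form the orthogonal complement. *)
Lemma moments_quadratic M (a b : nat -> nat) :
  (forall e, (e + 3 <= M)%N -> moment M a e = moment M b e) ->
  exists al be ga : rat, forall i, (i <= M)%N ->
    (a i)%:R - (b i)%:R = (-1) ^+ i * 'C(M, i)%:R * (al + be * i%:R + ga * i%:R ^+ 2).
Proof.
move=> ab; pose q i : rat := (-1) ^+ i * ((a i)%:R - (b i)%:R) / 'C(M, i)%:R.
have qE i : (i <= M)%N -> (a i)%:R - (b i)%:R = (-1) ^+ i * 'C(M, i)%:R * q i.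
  move=> iM; have C0 : ('C(M, i)%:R : rat) != 0 by rewrite pnatr_eq0 -lt0n bin_gt0.
  have : ((-1) ^+ i * (-1) ^+ i : rat) = 1 by rewrite -exprMn mulrNN mulr1 expr1n.
  rewrite /q; move: ((-1) ^+ i) => s ss.
  transitivity (s * s * ((a i)%:R - (b i)%:R) : rat); first by rewrite ss mul1r.
  by field.
clearbody q.
(* Coefficients of the quadratic interpolating [q] at 0, 1 and 2; the vanishing third differences
   propagate the agreement up to [M]. *)
pose ga : rat := (q 2%N - 2 * q 1%N + q 0%N) / 2.
pose be : rat := q 1%N - q 0%N - ga.
exists (q 0%N), be, ga => i iM; rewrite qE //; congr (_ * _).
elim/ltn_ind: i iM => -[|[|[|i]]] IH iM.
- by rewrite mulr0 expr0n mulr0 !addr0.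
- rewrite expr1n !mulr1 /be; move: (q 0%N) (q 1%N) (ga) => *; by ring.
- rewrite /be /ga; move: (q 0%N) (q 1%N) (q 2%N) => *; by field.
have := third_difference_zero (e := i) (M := M) _ (ab i _) qE.
rewrite !addnS !addn0 => -> //.
rewrite (IH i.+2) ?(IH i.+1) ?(IH i); try lia.
clearbody be; clearbody ga.
rewrite -!natr1.
move: (q 0%N) (be) (ga) (i%:R) => *; by ring.
Qed.

End Quadratic.

(** * Bounds on degree counts with equal moments *)

Ltac eval_bin H :=
  repeat match type of H with
  | context [binomial ?a ?b] =>
      let v := eval vm_compute in (binomial a b) in change (binomial a b) with v in H
  end.

Section DegreeCounts.
Variables (n : nat) (a b : nat -> nat).
Hypothesis suma : \sum_(i < n) a i = n.
Hypothesis sumb : \sum_(i < n) b i = n.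
Hypothesis eqm : forall e, e + 3 <= n.-1 -> moment n.-1 a e = moment n.-1 b e.

Lemma entry_le_sum (c : nat -> nat) i : \sum_(j < n) c j = n -> i < n -> c i <= n.
Proof. by move=> E ni; rewrite -[X in _ <= X]E (bigD1 (Ordinal ni)) //= leq_addr. Qed.

Lemma diff_le i : i < n -> a i <= n /\ b i <= n.
Proof. by move=> ni; split; apply: entry_le_sum. Qed.

(** Lagrange extrapolation gives q(0) = 10 q(3) - 15 q(4) + 6 q(5) for the quadratic q of
    [moments_quadratic]. Counts are at most n, so |q(i)| is at most n / C(n-1, i), which is small at
    3, 4 and 5, while q(0) = [a 0] is at least 1. *)
Lemma isolated_large : 13 < n -> 0 < a 0 -> b 0 = 0 -> False.
Proof.
move=> n14 a0 b0; have [al [be [ga qE]]] := moments_quadratic eqm.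
(* The factors 20, 50, 60 are chosen so that 10/20 + 15/50 + 6/60 = 9/10 < 1. The bounds for 3 and 4
   first hold at [N = 13]; the bound on 'C(N, 2) carries the induction for 'C(N, 3). *)
have bins N : 13 <= N -> [/\ 20 <= 'C(N, 2), 20 * N.+1 <= 'C(N, 3), 50 * N.+1 <= 'C(N, 4)
    & 60 * N.+1 <= 'C(N, 5)].
  elim: N => // N IH; rewrite leq_eqVlt => /orP [/eqP <- //|N13].
  have [h2 h3 h4 h5] := IH N13.
  by rewrite !binS; split; move: N13 h2 h3 h4 h5; rewrite ?bin1; lia.
have [|_ c3 c4 c5] := bins n.-1; first by lia.
rewrite prednK in c3 c4 c5; last by lia.
have aux i k : i < n -> 0 < k -> k * n <= 'C(n.-1, i) ->
    (`|al + be * i%:R + ga * i%:R ^+ 2| <= k%:R^-1)%R.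
  move=> ni k0 kC; have [ai bi] := diff_le ni.
  have C0 : (0 < 'C(n.-1, i)%:R :> rat)%R by rewrite ltr0n; nia.
  have := qE i; rewrite -ltnS prednK; last by lia.
  move=> /(_ ni); set q := (al + _ + _)%R => E.
  have : (`|(a i)%:R - (b i)%:R : rat| <= n%:R)%R.
    rewrite ler_norml; move: ai bi; rewrite -!(ler_nat rat) => ai bi.
    have := ler0n rat (a i); have := ler0n rat (b i); lra.
  rewrite E !normrM normrX normrN1 expr1n mul1r gtr0_norm //.
  move: kC; rewrite -(ler_nat rat) natrM => kC qn.
  have n0 : (0 < n%:R :> rat)%R by rewrite ltr0n; lia.
  have k0' : (0 < k%:R :> rat)%R by rewrite ltr0n.
  rewrite -(ler_pM2l k0') divff ?gt_eqF //.
  rewrite -(ler_pM2r n0) mul1r; apply: le_trans qn.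
  have := normr_ge0 q; nra.
have q3 := aux 3 20 ltac:(lia) isT c3.
have q4 := aux 4 50 ltac:(lia) isT c4.
have q5 := aux 5 60 ltac:(lia) isT c5.
have := qE 0 isT; rewrite b0 bin0 expr0 mul1r subr0 mulr0 expr0n /= mulr0 !addr0 mul1r => a0E.
have : (1 <= (a 0)%:R :> rat)%R by rewrite ler1n.
have -> : ((a 0)%:R = 10 * (al + be * 3%:R + ga * 3%:R ^+ 2) -
    15 * (al + be * 4%:R + ga * 4%:R ^+ 2) + 6 * (al + be * 5%:R + ga * 5%:R ^+ 2) :> rat)%R.
  by rewrite a0E; ring.
move: q3 q4 q5; move: (al + _ + _)%R (al + _ + _)%R (al + _ + _)%R => q3 q4 q5.
move=> /ler_normlP [_ h3] /ler_normlP [h4 _] /ler_normlP [_ h5] h0.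
clear -h0 h3 h4 h5; lra.
Qed.

End DegreeCounts.


Ltac eval_arg a H :=
  repeat match type of H with
  | context [a (addn ?i ?j)] =>
      let v := eval vm_compute in (i + j) in change (a (addn i j)) with (a v) in H
  end.

(** Instantiates the moment equation at e = 0, 1, ... until [isT] no longer proves the side
    condition, leaving explicit linear equations for [lia]. *)
Ltac get_moments M a b eqm :=
  let rec go e :=
    first [ let H := fresh "m" in
            have H := eqm e isT;
            rewrite !(@moment4 M) // !big_ord_recl !big_ord0 /= /bump /= in H;
            eval_bin H; eval_arg a H; eval_arg b H;
            let e' := eval compute in (S e) in go e'
          | clear eqm ] in
  go 0.

(** Here [a] belongs to the graph with an isolated vertex, which therefore has no vertex adjacent to
    all others: hence [a n.-1 = 0]. From 14 vertices on the extrapolation bound applies; in the six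
    remaining cases the linear equations have no solution in natural numbers. *)
Lemma isolated_counts_false n (a b : nat -> nat) :
  7 < n -> \sum_(i < n) a i = n -> \sum_(i < n) b i = n ->
  (forall e, e + 3 <= n.-1 -> moment n.-1 a e = moment n.-1 b e) ->
  0 < a 0 -> b 0 = 0 -> a n.-1 = 0 -> False.
Proof.
move=> n8 suma sumb eqm a0 b0 aN.
have [n14|] := ltnP 13 n; first exact: (isolated_large suma sumb eqm).
move=> n13.
have : n \in [:: 8; 9; 10; 11; 12; 13] by rewrite !inE; lia.
rewrite !inE => /or4P [/eqP e|/eqP e|/eqP e|/or3P [/eqP e|/eqP e|/eqP e]]; subst n;
  rewrite !big_ord_recl !big_ord0 /= /bump /= in suma sumb eqm aN;
  eval_arg a suma; eval_arg b sumb.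
- by get_moments 7 a b eqm; lia.
- by get_moments 8 a b eqm; lia.
- by get_moments 9 a b eqm; lia.
- by get_moments 10 a b eqm; lia.
- by get_moments 11 a b eqm; lia.
- by get_moments 12 a b eqm; lia.
Qed.

(** For seven vertices the equations are solvable. These two bounds are all that [leaves_and_clique]
    needs to identify the connected graph. *)
Lemma isolated_counts7 (a b : nat -> nat) :
  \sum_(i < 7) a i = 7 -> \sum_(i < 7) b i = 7 ->
  (forall e, e + 3 <= 6 -> moment 6 a e = moment 6 b e) ->
  0 < a 0 -> b 0 = 0 -> a 6 = 0 ->
  3 <= b 1 /\ 3 <= b 4.
Proof.
move=> suma sumb eqm a0 b0 aN.
rewrite !big_ord_recl !big_ord0 /= /bump /= in suma sumb.
eval_arg a suma; eval_arg b sumb.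
get_moments 6 a b eqm.
by split; lia.
Qed.

Lemma natr_dist_ge1 (i j : nat) : i != j -> (1 <= `|i%:R - j%:R| :> rat)%R.
Proof.
wlog ij : i j / i <= j => [H|] neq.
  by case: (leqP i j) => [|/ltnW] ij; [|rewrite distrC]; apply: H => //; rewrite eq_sym.
by rewrite distrC -natrB // normr_nat ler1n subn_gt0 ltn_neqAle neq.
Qed.

(** Agreement at 0 leaves i (be + ga i) as the quadratic. As [a] vanishes at the two largest degrees
    and [b] is nonnegative, the linear factor changes sign weakly between them, so its size does not
    increase up to degree n - 2. A nonzero integer difference at degree 1 then forces a difference
    larger than n at degree 3. *)
Lemma no_isolated_counts n (a b : nat -> nat) :
  7 <= n -> \sum_(i < n) a i = n -> \sum_(i < n) b i = n ->
  (forall e, e + 3 <= n.-1 -> moment n.-1 a e = moment n.-1 b e) ->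
  a 0 = 0 -> b 0 = 0 -> a n.-2 = 0 -> a n.-1 = 0 -> forall i, i < n -> a i = b i.
Proof.
move=> n7 suma sumb eqm a0 b0 aN1 aN.
have [n8|] := ltnP 7 n; last first.
  move=> n8; have e : n = 7 by lia.
  subst n; move=> i i7.
  rewrite !big_ord_recl !big_ord0 /= /bump /= in suma sumb aN aN1.
  eval_arg a suma; eval_arg b sumb.
  get_moments 6 a b eqm.
  by case: i i7 => [|[|[|[|[|[|[|i]]]]]]] // _; lia.
have [al [be [ga qE]]] := moments_quadratic eqm.
have [N nN N7] : exists2 N, n = N.+1 & 7 <= N by exists n.-1; lia.
subst n; rewrite /= in aN1 aN qE.
have al0 : al = 0%R.
  by have := qE 0 isT; rewrite a0 b0 bin0 expr0 mul1r subr0 mulr0 expr0n /= mulr0 !addr0 mul1r.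
pose x : rat := (N%:R)%R.
have x7 : (7 <= x)%R by rewrite /x ler_nat.
(* [q i = i (be + ga i)] changes sign between [N - 1] and [N]. *)
have [s [s1 su sv]] : exists s : rat, [/\ (s = 1 \/ s = -1)%R,
    (s * (be + ga * x) <= 0)%R & (0 <= s * (be + ga * (x - 1)))%R].
  exists ((-1) ^+ N)%R; have := qE N (leqnn N); have := qE N.-1 (leq_pred N).
  have eN : (N.-1%:R = x - 1 :> rat)%R by rewrite /x -(prednK (n := N)) ?succnK -?natr1 ?addrK //; lia.
  rewrite aN aN1 al0 !sub0r !add0r eN -/x binn.
  have -> : 'C(N, N.-1) = N by rewrite -subn1 bin_sub ?bin1; lia.
  rewrite -/x; have := ler0n rat (b N); have := ler0n rat (b N.-1).
  have e0 : ((-1) ^+ N.-1 = - (-1) ^+ N :> rat)%R.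
    by rewrite -{2}(prednK (n := N)) ?exprS ?mulN1r ?opprK //; lia.
  have s1 : ((-1) ^+ N = 1 :> rat \/ (-1) ^+ N = -1 :> rat)%R.
    by rewrite -signr_odd; case: (odd N); [right|left].
  rewrite e0; move: s1; move: ((-1) ^+ N)%R ((b N)%:R)%R ((b N.-1)%:R)%R => s y1 y2 s1 h1 h2 e1 e2.
  have x0 : (0 < x)%R by lra.
  have x1 : (0 < x * (x - 1))%R by rewrite mulr_gt0 //; lra.
  split=> //.
  - by rewrite -(pmulr_rle0 _ x0); lra.
  - by rewrite -(pmulr_rge0 _ x1); lra.
have bin3 : ('C(N, 3)%:R = x * (x - 1) * (x - 2) / 6 :> rat)%R.
  have : ('C(N, 3)%:R * 6 = x * (x - 1) * (x - 2) :> rat)%R.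
    have -> : (6 = (3`!)%:R :> rat)%R by [].
    rewrite -natrM bin_ffact /x; case: (N) N7 => [|[|[|k]]] // _.
    by rewrite !ffactnS ffactn0 /= muln1 !natrM -!natr1; ring.
  by move=> <-; field.
(* With these, s (be + ga i) = v + g (x - 1 - i), where [v] and [g] are nonnegative. *)
pose v : rat := (s * (be + ga * (x - 1)))%R; pose g : rat := (- s * ga)%R.
have v0 : (0 <= v)%R by [].
have g0 : (0 <= g)%R by rewrite /g; lra.
have ss : (s * s = 1)%R by case: s1 => ->; rewrite ?mulrNN mulr1.
have e1 : (s * ((a 1)%:R - (b 1)%:R) = - (x * (v + g * (x - 2))))%R.
  by rewrite qE ?bin1 ?al0 -/x; [rewrite /v /g; ring|lia].
have e3 : (s * ((a 3)%:R - (b 3)%:R) = - (x * (x - 1) * (x - 2) / 2 * (v + g * (x - 4))))%R.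
  by rewrite qE ?bin3 ?al0; [rewrite /v /g; field|lia].
have [Y0|Y0] := eqVneq (v + g * (x - 2))%R 0%R.
  have g00 : g = 0%R.
    have : (0 <= g * (x - 7))%R by rewrite mulr_ge0 //; lra.
    by move=> h; apply/eqP; rewrite eq_le g0 andbT; lra.
  have v00 : v = 0%R by rewrite g00 mul0r addr0 in Y0.
  have ga0 : ga = 0%R.
    by apply: (mulfI (x := (- s)%R)); [case: s1 => ->; rewrite ?opprK ?oppr_eq0 oner_eq0|rewrite mulr0].
  have be0 : be = 0%R.
    apply: (mulfI (x := s)); first by case: s1 => ->; rewrite ?oppr_eq0 oner_eq0.
    by rewrite mulr0 -v00 /v ga0 mul0r addr0.
  move=> i iN; have := qE i iN; rewrite al0 be0 ga0 !mul0r !addr0 mulr0 => /eqP.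
  by rewrite subr_eq0 eqr_nat => /eqP.
have Y_ge0 : (0 <= g * (x - 2))%R by rewrite mulr_ge0 //; lra.
have Y_gt0 : (0 < v + g * (x - 2))%R by rewrite lt_neqAle eq_sym Y0 /= addr_ge0.
have Y1 : (1 <= x * (v + g * (x - 2)))%R.
  have : (x * (v + g * (x - 2)) = `|(a 1)%:R - (b 1)%:R|)%R.
    have <- : (`|s * ((a 1)%:R - (b 1)%:R)| = `|(a 1)%:R - (b 1)%:R|)%R.
      by case: s1 => ->; rewrite ?mul1r // mulN1r normrN.
    by rewrite e1 normrN ger0_norm // mulr_ge0 //; lra.
  have : (0 < x * (v + g * (x - 2)))%R by rewrite mulr_gt0 //; lra.
  move=> p0 E; rewrite E normr_gt0 subr_eq0 eqr_nat in p0.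
  by rewrite E natr_dist_ge1.
have h1 : ((x - 4) * (v + g * (x - 2)) <= (x - 2) * (v + g * (x - 4)))%R by lra.
have h2 : ((x - 1) * (x - 4) / 2 * (x * (v + g * (x - 2))) <=
   x * (x - 1) * (x - 2) / 2 * (v + g * (x - 4)))%R.
  have := ler_wpM2l (_ : 0 <= x * (x - 1) / 2)%R h1.
  by move=> /(_ ltac:(rewrite !mulr_ge0 //; lra)); lra.
have h3 : ((x - 1) * (x - 4) / 2 <= (x - 1) * (x - 4) / 2 * (x * (v + g * (x - 2))))%R.
  by apply: ler_peMr => //; rewrite !mulr_ge0 //; lra.
(* At [x = 7] this reads 8 < 9; at [x = 6] it fails, which is why [n = 7] was settled by
   arithmetic. *)
have h4 : (x + 1 < (x - 1) * (x - 4) / 2)%R.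
  have : (0 <= (x - 7) * x)%R by rewrite mulr_ge0 //; lra.
  lra.
have : (`|(a 3)%:R - (b 3)%:R| <= x + 1 :> rat)%R.
  have [|a3 b3] := diff_le (i := 3) suma sumb; first by apply: leq_trans (leqW N7).
  move: a3 b3; rewrite -!(ler_nat rat) -natr1 -/x => a3 b3.
  have := ler0n rat (a 3); have := ler0n rat (b 3).
  by move=> a30 b30; apply/ler_normlP; split; lra.
have <- : (`|s * ((a 3)%:R - (b 3)%:R)| = `|(a 3)%:R - (b 3)%:R| :> rat)%R.
  by case: s1 => ->; rewrite ?mul1r // mulN1r normrN.
by rewrite e3 normrN ger0_norm; lra.
Qed.

(** * Counting vertices and induced paths through the cards *)

Lemma double_count (I J : finType) (P : pred I) (R : I -> J -> bool) :
  \sum_(i | P i) #|[set j | R i j]| = \sum_j #|[set i | P i && R i j]|.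
Proof.
transitivity (\sum_(i | P i) \sum_j (R i j : nat)).
  apply: eq_bigr => i _; rewrite -sum1_card big_mkcond /=.
  by apply: eq_bigr => j _; rewrite inE; case: (R i j).
rewrite exchange_big /=; apply: eq_bigr => j _.
rewrite -sum1_card big_mkcond [RHS]big_mkcond; apply: eq_bigr => i _.
by rewrite inE; case: (P i); case: (R i j).
Qed.

Lemma sum_by_value (U : finType) (P : pred U) (d : U -> nat) (F : nat -> nat) M :
  (forall u, P u -> d u <= M) ->
  \sum_(u | P u) F (d u) = \sum_(i < M.+1) #|[set u | P u & d u == i]| * F i.
Proof.
move=> dM; rewrite (partition_big (fun u => inord (d u) : 'I_M.+1) predT) //=.
apply: eq_bigr => i _; rewrite -sum_nat_const big_mkcond [RHS]big_mkcond /=.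
apply: eq_bigr => u _; rewrite inE.
case Pu: (P u) => //=; rewrite -val_eqE /= inordK ?ltnS ?dM //.
by case: eqP => // ->.
Qed.

Section Draws.
Variable V : finType.
Implicit Types A B T X Y : {set V}.

(** Such a set is determined by its traces on [A] and [B], which can be chosen independently. *)
Lemma card_two_draws A B i j : [disjoint A & B] ->
  #|[set T : {set V} | [&& T \subset A :|: B, #|T :&: A| == i & #|T :&: B| == j]]|
    = 'C(#|A|, i) * 'C(#|B|, j).
Proof.
move=> dAB; have AB0 : A :&: B = set0 by apply: disjoint_setI0.
rewrite -!cards_draws -cardsX.
pose D := setX [set P : {set V} | P \subset A & #|P| == i]
               [set P : {set V} | P \subset B & #|P| == j].
have trace (P Q : {set V}) : P \subset A -> Q \subset B ->
    (P :|: Q) :&: A = P /\ (P :|: Q) :&: B = Q.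
  move=> PA QB; rewrite !setIUl.
  rewrite (setIidPl PA) (setIidPl QB); split.
    have -> : Q :&: A = set0.
      by apply/eqP; rewrite -subset0 -AB0 setIC; apply: setIS.
    by rewrite setU0.
  have -> : P :&: B = set0 by apply/eqP; rewrite -subset0 -AB0; apply: setSI.
  by rewrite set0U.
rewrite -/D -(@card_in_imset _ _ (fun p => p.1 :|: p.2) D).
  apply: eq_card => T; rewrite inE; apply/and3P/imsetP => [[sT cA cB]|].
    exists (T :&: A, T :&: B) => /=; last by rewrite -setIUr (setIidPl sT).
    by rewrite !inE /= !subsetIr cA cB.
  case=> -[P Q]; rewrite !inE /= => /andP [/andP [PA cP] /andP [QB cQ]] ->.
  by have [-> ->] := trace _ _ PA QB; rewrite setUSS.
move=> [P Q] [P' Q']; rewrite !inE /= => /andP [/andP [PA _] /andP [QB _]].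
move=> /andP [/andP [PA' _] /andP [QB' _]] e.
have [p1 p2] := trace _ _ PA QB; have [p1' p2'] := trace _ _ PA' QB'.
by congr (_, _); [rewrite -p1 e p1'|rewrite -p2 e p2'].
Qed.

(** Beyond [X], the set consists of [i] elements of [Y] and [m - i] elements outside both, drawn
    independently. *)
Lemma card_draws_over X Y i m : Y \subset ~: X -> i <= m ->
  #|[set T : {set V} | [&& #|T| == #|X| + m, X \subset T & #|T :&: Y| == i]]|
    = 'C(#|Y|, i) * 'C(#|V| - #|X| - #|Y|, m - i).
Proof.
move=> YX im; pose B := ~: X :\: Y.
have cB : #|B| = #|V| - #|X| - #|Y|.
  by rewrite cardsD (setIidPr YX) cardsCs setCK.
have dYB : [disjoint Y & B] by rewrite -setI_eq0 /B setDE setICA setICr setI0.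
have YUB : Y :|: B = ~: X by rewrite /B setDE setUIr setUCr setIT; apply/setUidPr.
rewrite -cB -(card_two_draws _ _ dYB) YUB.
rewrite -[RHS](@card_in_imset _ _ (fun T => X :|: T)); last first.
  move=> T T'; rewrite !inE => /and3P [sT _ _] /and3P [sT' _ _] e.
  have h (Z : {set V}) : Z \subset ~: X -> Z = (X :|: Z) :&: ~: X.
    by move=> sZ; rewrite setIUl setICr set0U (setIidPl sZ).
  by rewrite (h _ sT) (h _ sT') e.
apply: eq_card => T; rewrite inE; apply/and3P/imsetP.
  case=> /eqP cT XT /eqP iT; exists (T :\: X); last first.
    by rewrite setDE setUIr setUCr setIT; apply/esym/setUidPr.
  have e1 : (T :\: X) :&: Y = T :&: Y.
    apply/setP=> x; rewrite !inE; have := subsetP YX x; rewrite inE.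
    by case: (x \in Y) => [->|] //; rewrite !andbF.
  have e2 : #|T :\: X| = m by rewrite cardsD (setIidPr XT) cT addKn.
  have e3 : (T :\: X) :&: B = (T :\: X) :\: Y.
    by apply/setP=> x; rewrite !inE; case: (x \in X); case: (x \in Y); case: (x \in T).
  by rewrite inE e1 iT eqxx e3 cardsD e2 e1 iT eqxx setDE subsetIr.
case=> T'; rewrite inE => /and3P [sT /eqP iT /eqP jT] ->.
have XT0 : X :&: T' = set0.
  by apply/eqP; rewrite setI_eq0 disjoint_sym -[X]setCK disjoints_subset setCK.
have XY0 : X :&: Y = set0.
  by apply/eqP; rewrite setI_eq0 disjoint_sym -[X]setCK disjoints_subset setCK.
have cT' : #|T'| = m.
  have <- : T' :&: (Y :|: B) = T' by rewrite YUB (setIidPl sT).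
  rewrite setIUr cardsU iT jT setIACA (disjoint_setI0 dYB) setI0 cards0; lia.
by rewrite cardsU XT0 cards0 subn0 cT' setIUl XY0 set0U iT subsetUl.
Qed.

End Draws.

Section Graphs.
Variables (V : finType) (g : rel V).
Implicit Types (S T X : {set V}) (x y u v w : V).

Definition nb x := [set y | g x y].
Definition deg x := #|nb x|.
Definition degin S x := #|S :&: nb x|.
(** For a simple graph this is twice the number of edges inside [S]. *)
Definition vol S := \sum_(x in S) degin S x.
(** Induced paths on three vertices as ordered triples, so that each path is listed once from either
    end. *)
Definition p3 (t : V * V * V) :=
  [&& g t.1.1 t.1.2, g t.1.2 t.2, ~~ g t.1.1 t.2 & t.1.1 != t.2].
Definition degcount i := #|[set x | deg x == i]|.
(* The index is the number of neighbours of the first vertex other than the second. *)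
Definition p3count i := #|[set t | p3 t & deg t.1.1 == i.+1]|.

Hypotheses (irr : irreflexive g) (sym : symmetric g).

Lemma deg_lt x : deg x <= #|V|.-1.
Proof.
suff : deg x < #|V| by lia.
rewrite -cardsT; apply: proper_card; rewrite properT.
by apply/eqP=> /setP /(_ x); rewrite !inE irr.
Qed.

Lemma sum_degcount : \sum_(i < #|V|) degcount i = #|V|.
Proof.
have [V0|V0] := posnP #|V|; first by rewrite V0 big_ord0.
rewrite -[RHS]cardsT -[RHS]sum1_card [RHS](eq_bigl predT) => [|x]; last by rewrite !inE.
rewrite [RHS](sum_by_value (fun=> 1) (M := #|V|.-1) (d := deg)) => [|u _]; last exact: deg_lt.
by rewrite prednK //; apply: eq_bigr => i _; rewrite muln1.
Qed.

(** Exchange the sums: a card in which a fixed vertex of degree [i] has degree [e] picks [e] of its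
    [i] neighbours and [k - 1 - e] of its non-neighbours. *)
Lemma degcount_moment k e : k + 3 = #|V| -> e < k ->
  \sum_(T : {set V} | #|T| == k) #|[set x | (x \in T) && (degin T x == e)]| =
  moment #|V|.-1 degcount e.
Proof.
move=> kV ek; rewrite double_count /moment.
rewrite -(@sum_by_value _ predT deg (fun i => 'C(i, e) * 'C(#|V|.-1 - i, #|V|.-1 - 3 - e)))
  => [|x _]; last exact: deg_lt.
apply: eq_bigr => x _.
have -> : #|V|.-1 - deg x = #|V| - #|[set x]| - #|nb x| by rewrite cards1 subn1.
have -> : #|V|.-1 - 3 - e = k.-1 - e by lia.
rewrite -card_draws_over; [|by rewrite subsetC sub1set !inE irr|lia].
apply: eq_card => T; rewrite !inE cards1 sub1set; congr ((_ == _) && _); lia.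
Qed.

(** Once the path is fixed, a card containing it omits three of the other [#|V| - 3] vertices, so
    the same kind of moment appears with [#|V| - 3] in place of [#|V|.-1]. Of the neighbours of the
    first vertex only the middle one is on the path, whence the shift by one in the degrees. *)
Lemma p3_moment k e : k + 3 = #|V| -> e + 3 <= k ->
  \sum_(T : {set V} | #|T| == k)
     #|[set t | p3 t && [&& t.1.1 \in T, t.1.2 \in T, t.2 \in T & degin T t.1.1 == e.+1]]| =
  moment (#|V| - 3) p3count e.
Proof.
move=> kV ek; rewrite double_count /moment.
pose F i := 'C(i, e) * 'C(#|V| - 3 - i, #|V| - 3 - 3 - e).
have sub t : p3 t -> (deg t.1.1).-1 <= #|V| - 3.
  case: t => [[u v] w] /and4P [/= uv vw nuw neq].
  have uv' : u != v by apply: contraTneq uv => ->; rewrite irr.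
  have vw' : v != w by apply: contraTneq vw => ->; rewrite irr.
  have cX : #|[set u; v; w]| = 3 by rewrite -setUA cardsU1 cards2 !inE negb_or uv' neq vw'.
  have : nb u :\ v \subset ~: [set u; v; w].
    rewrite subsetC; apply/subsetP => z; rewrite !inE -orbA.
    by case/or3P => /eqP ->; rewrite ?irr ?eqxx ?(negbTE nuw) ?andbF.
  move=> /subset_leq_card; rewrite [X in _ <= X -> _]cardsCs setCK cX.
  by rewrite /deg /= (cardsD1 v (nb u)) inE uv add1n.
transitivity (\sum_(t | p3 t) F (deg t.1.1).-1); last first.
  rewrite (sum_by_value F sub); apply: eq_bigr => i _; congr (_ * _).
  apply: eq_card => t; rewrite !inE; case pt: (p3 t) => //=.
  have : 0 < deg t.1.1 by apply/card_gt0P; exists t.1.2; rewrite inE; case/and4P: pt.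
  by move=> d0; rewrite -eqSS prednK.
rewrite [RHS]big_mkcond /=; apply: eq_bigr => -[[u v] w] _.
case pt: (p3 (u, v, w)); last first.
  by apply: eq_card0 => T; rewrite !inE andbF.
have /and4P [/= uv vw nuw neq] := pt.
have uv' : u != v by apply: contraTneq uv => ->; rewrite irr.
have vw' : v != w by apply: contraTneq vw => ->; rewrite irr.
have cX : #|[set u; v; w]| = 3 by rewrite -setUA cardsU1 cards2 !inE negb_or uv' neq vw'.
have cY : (deg u).-1 = #|nb u :\ v| by rewrite /deg (cardsD1 v) inE uv.
rewrite /F /= cY.
have -> : #|V| - 3 - 3 - e = k - 3 - e by lia.
have YX : nb u :\ v \subset ~: [set u; v; w].
  rewrite subsetC; apply/subsetP => z; rewrite !inE -orbA.
  by case/or3P => /eqP ->; rewrite ?irr ?eqxx ?(negbTE nuw) ?andbF.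
have := card_draws_over (i := e) (m := k - 3) YX; rewrite cX subnKC; last by lia.
move=> <-; last by lia.
apply: eq_card => T; rewrite !inE.
rewrite !subUset !sub1set -!andbA; congr (_ && _).
case: (u \in T) => //=; case vT: (v \in T) => //=; case: (w \in T) => //=.
by rewrite /degin (cardsD1 v) !inE vT uv /= eqSS setIDA.
Qed.

End Graphs.

(** * Connected vertex sets *)

Lemma connect_homo (V W : finType) (e : rel V) (e' : rel W) (f : V -> W) x y :
  (forall a b, e a b -> e' (f a) (f b)) -> connect e x y -> connect e' (f x) (f y).
Proof.
move=> ee' /connectP [p pth ->]; elim: p x pth => [|z p IH] x /=; first by rewrite connect0.
by case/andP => xz /IH; apply: connect_trans; apply/connect1/ee'.
Qed.

Lemma connect_exit (V : finType) (e : rel V) (X : {set V}) x y :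
  connect e x y -> x \in X -> y \notin X -> exists a b, [/\ a \in X, b \notin X & e a b].
Proof.
move=> /connectP [p pth ->]; elim: p x pth => [|z p IH] x /=; first by move=> _ ->.
case/andP => xz pth xX; have [zX|zX] := boolP (z \in X); first exact: IH.
by exists x, z.
Qed.

Definition restrict (V : finType) (g : rel V) (S : {set V}) : rel V :=
  fun x y => [&& g x y, x \in S & y \in S].

Definition conn (V : finType) (g : rel V) (S : {set V}) : bool :=
  [forall x in S, forall y in S, connect (restrict g S) x y].

Lemma connP (V : finType) (g : rel V) (S : {set V}) :
  reflect {in S &, forall x y, connect (restrict g S) x y} (conn g S).
Proof.
apply: (iffP forall_inP) => [h x y xS yS|h x xS].
  by have /forall_inP := h x xS; apply.
by apply/forall_inP => y; apply: h.
Qed.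

Section Invariance.
Variables (V W : finType) (g : rel V) (h : rel W) (S : {set V}) (T : {set W}).

Lemma degin_iso (f : V -> W) x : {in S &, injective f} -> f @: S = T ->
  {in S &, forall x y, g x y = h (f x) (f y)} -> x \in S ->
  degin h T (f x) = degin g S x.
Proof.
move=> injf <- fgh xS; rewrite /degin.
have -> : f @: S :&: nb h (f x) = f @: (S :&: nb g x).
  apply/setP=> z; apply/setIP/imsetP => [[/imsetP [y yS ->]]|[y]].
    by rewrite inE -fgh // => gxy; exists y; rewrite // !inE yS.
  by rewrite !inE => /andP [yS gxy] ->; rewrite imset_f // -fgh.
by rewrite card_in_imset // => a b /setIP [aS _] /setIP [bS _]; apply: injf.
Qed.

Hypothesis gh : card_iso g h S T.

Lemma vol_iso : vol g S = vol h T.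
Proof.
case: gh => f [injf fS fgh]; rewrite /vol -{1}fS big_imset //=.
by apply: eq_bigr => x xS; rewrite (degin_iso injf fS fgh).
Qed.

Lemma degin_count_iso e :
  #|[set x | (x \in S) && (degin g S x == e)]| = #|[set x | (x \in T) && (degin h T x == e)]|.
Proof.
case: gh => f [injf fS fgh].
rewrite -(@card_in_imset _ _ f); last first.
  by move=> a b; rewrite !inE => /andP [aS _] /andP [bS _]; apply: injf.
apply: eq_card => z; rewrite !inE; apply/imsetP/andP => [[x]|[]].
  by rewrite inE => /andP [xS dx] ->; rewrite -fS imset_f // fS (degin_iso injf fS fgh).
rewrite -{1}fS => /imsetP [x xS ->]; rewrite (degin_iso injf fS fgh) // => dx.
by exists x; rewrite // inE xS.
Qed.

Lemma p3_count_iso e :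
  #|[set t | p3 g t && [&& t.1.1 \in S, t.1.2 \in S, t.2 \in S & degin g S t.1.1 == e]]| =
  #|[set t | p3 h t && [&& t.1.1 \in T, t.1.2 \in T, t.2 \in T & degin h T t.1.1 == e]]|.
Proof.
case: gh => f [injf fS fgh].
pose f3 (t : V * V * V) := (f t.1.1, f t.1.2, f t.2).
rewrite -(@card_in_imset _ _ f3); last first.
  move=> [[a b] c] [[a' b'] c']; rewrite !inE /= => /and5P [_ aS bS cS _] /and5P [_ a'S b'S c'S _].
  by case=> /(injf _ _ aS a'S) -> /(injf _ _ bS b'S) -> /(injf _ _ cS c'S) ->.
have p3f a b c : a \in S -> b \in S -> c \in S -> p3 h (f a, f b, f c) = p3 g (a, b, c).
  by move=> aS bS cS; rewrite /p3 /= -!fgh // (inj_in_eq injf).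
apply: eq_card => -[[a b] c]; rewrite !inE /=; apply/imsetP/and5P.
  case=> -[[a' b'] c']; rewrite !inE /= => /and5P [pt aS bS cS da] [-> -> ->].
  by rewrite -fS !imset_f // fS p3f // (degin_iso injf fS fgh).
rewrite -{1 2 3}fS => -[pt /imsetP [a' aS ea] /imsetP [b' bS eb] /imsetP [c' cS ec]].
move: pt; rewrite ea eb ec p3f // (degin_iso injf fS fgh) // => pt da.
by exists (a', b', c'); rewrite // !inE pt aS bS cS.
Qed.

Lemma conn_iso : conn g S = conn h T.
Proof.
case: gh => f [injf fS fgh].
apply/connP/connP => [c x y|c x y xS yS].
  rewrite -{1 2}fS => /imsetP [x' xS ->] /imsetP [y' yS ->].
  apply: (connect_homo (e := restrict g S)); last exact: c.
  by move=> a b /and3P [ab aS bS]; rewrite /restrict -fgh // ab -fS !imset_f.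
have fT z : z \in S -> f z \in T by rewrite -fS; apply: imset_f.
(* A left inverse of [f] on [S], to carry paths back; the default is never reached on [T]. *)
pose r z := odflt x [pick a in S | f a == z].
have rK a : a \in S -> r (f a) = a.
  move=> aS; rewrite /r; case: pickP => [b /andP [bS /eqP /injf ->] //|/(_ a)].
  by rewrite aS eqxx.
have := c (f x) (f y) (fT _ xS) (fT _ yS).
move=> /(connect_homo (f := r) (e' := restrict g S)); rewrite !rK //; apply.
move=> a b /and3P [+ aT bT]; rewrite -fS in aT bT.
case/imsetP: aT => a' aS ->; case/imsetP: bT => b' bS ->.
by rewrite !rK // /restrict -fgh // aS bS => ->.
Qed.

End Invariance.

Section Connectivity.
Variables (V : finType) (g : rel V).
Hypotheses (irr : irreflexive g) (sym : symmetric g).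
Implicit Types (S T X C : {set V}).

Lemma restrict_sym S : connect_sym (restrict g S).
Proof.
by apply: sym_connect_sym => x y; rewrite /restrict sym; case: (x \in S); case: (y \in S).
Qed.

Lemma restrict_sub S T x y : S \subset T ->
  connect (restrict g S) x y -> connect (restrict g T) x y.
Proof.
move=> ST; apply: (connect_homo (f := id)) => a b /and3P [ab aS bS].
by rewrite /restrict ab !(subsetP ST).
Qed.

Lemma conn_root w S : (forall x, x \in S -> connect (restrict g S) w x) -> conn g S.
Proof.
move=> h; apply/connP => x y xS yS; apply: connect_trans (h y yS).
by rewrite restrict_sym; apply: h.
Qed.

Lemma restrict1 S x y : g x y -> x \in S -> y \in S -> connect (restrict g S) x y.
Proof. by move=> xy xS yS; apply: connect1; rewrite /restrict xy xS yS. Qed.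

Lemma conn_add S a y : conn g S -> a \in S -> g a y -> conn g (y |: S).
Proof.
move=> /connP cS aS ay; apply: (conn_root (w := a)) => x /setU1P [->|xS].
  by apply: restrict1; rewrite // !inE ?eqxx ?aS ?orbT.
by apply: restrict_sub (subsetUr _ _) _; apply: cS.
Qed.

Lemma conn1 x : conn g [set x].
Proof. by apply/connP=> a b /set1P -> /set1P ->; apply: connect0. Qed.

Lemma conn_grow S X m : conn g X -> X \subset S -> #|X| <= m -> m <= #|S| ->
  (forall Y : {set V}, X \subset Y -> Y \proper S ->
     exists a b, [/\ a \in Y, b \in S :\: Y & g a b]) ->
  exists T : {set V}, [/\ X \subset T, T \subset S, #|T| = m & conn g T].
Proof.
move=> cX XS Xm mS ext; rewrite -(subnKC Xm) in mS *; move: (m - #|X|) mS => d {Xm m}.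
elim: d => [|d IH] dS; first by exists X; rewrite addn0.
have [|Y [XY YS cY connY]] := IH; first by lia.
have [|a [b [aY /setDP [bS bY] ab]]] := ext Y XY.
  by rewrite properEcard YS cY; lia.
exists (b |: Y); split; last exact: conn_add ab.
- exact: subset_trans XY (subsetUr _ _).
- by rewrite subUset sub1set bS.
- by rewrite cardsU1 bY cY addnS.
Qed.

Lemma conn_exists x m : (forall x y, connect g x y) -> 0 < m <= #|V| ->
  exists T : {set V}, [/\ x \in T, #|T| = m & conn g T].
Proof.
move=> cg /andP [m0 mV].
have [||||Y xY|T [xT _ cT connT]] := @conn_grow setT [set x] m.
- exact: conn1.
- exact: subsetT.
- by rewrite cards1.
- by rewrite cardsT.
- rewrite properT => /eqP YT; have [y yY] : exists y, y \notin Y.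
    apply/existsP; rewrite -negb_forall; apply: contra_notN YT => /forallP h.
    by apply/setP=> z; rewrite h inE.
  have xY' : x \in Y by rewrite -sub1set.
  have [a [b [aY bY ab]]] := connect_exit (cg x y) xY' yY.
  by exists a, b; rewrite !inE bY.
- by exists T; rewrite -sub1set.
Qed.

Lemma conn_sub_closed T C x : conn g T -> x \in T -> x \in C ->
  (forall a b, a \in C -> g a b -> b \in C) -> T \subset C.
Proof.
move=> /connP cT xT xC clC; apply/subsetP=> y yT; apply: contraT => yC.
have [a [b [aC bC /and3P [ab _ _]]]] := connect_exit (cT x y xT yT) xC yC.
by rewrite (clC a b) in bC.
Qed.

Lemma conn_component x : conn g [set y | connect g x y].
Proof.
set C := [set y | _]; apply: (conn_root (w := x)) => y; rewrite inE => xy.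
apply: contraT => nxy.
pose X := [set z | connect (restrict g C) x z].
have [||a [b []]] := connect_exit (X := X) xy; [by rewrite inE connect0|by rewrite inE|].
rewrite !inE => xa /negP nxb ab; case: nxb; apply: (connect_trans xa).
have gxa : connect g x a by apply: (connect_homo (f := id)) xa => c d /and3P [].
by apply: restrict1; rewrite // inE //; apply: connect_trans gxa (connect1 ab).
Qed.

(** Two connected cards meet, since 2(n - 3) > n for n >= 7, so they lie in one component. Being
    distinct, they force it to have more than n - 3 vertices, which leaves at most two vertices
    outside. *)
Lemma disconnected_structure : 7 <= #|V| -> (~ forall x y, connect g x y) ->
  1 < #|[set S : {set V} | (#|S| == #|V| - 3) && conn g S]| ->
  (exists z, deg g z = 0) \/
  exists (C : {set V}) b1 b2, [/\ #|C| = #|V| - 2, conn g C, ~: C = [set b1; b2], g b1 b2 &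
                   forall a b, a \in C -> g a b -> b \in C].
Proof.
move=> n7 ncon /card_gt1P [T1 [T2 []]].
rewrite !inE => /andP [/eqP c1 k1] /andP [/eqP c2 k2] neq.
have [x xT1] : exists x, x \in T1 by apply/card_gt0P; lia.
pose C := [set y | connect g x y].
have clC a b : a \in C -> g a b -> b \in C.
  by rewrite !inE => xa ab; apply: connect_trans xa (connect1 ab).
have cC : conn g C by apply: conn_component.
have T1C : T1 \subset C by apply: conn_sub_closed xT1 _ _; rewrite ?inE ?connect0.
have T2C : T2 \subset C.
  have [y] : exists y, y \in T1 :&: T2.
    apply/card_gt0P; have := max_card (mem (T1 :|: T2)); rewrite cardsU; lia.
  by case/setIP => yT1 yT2; apply: conn_sub_closed yT2 _ clC => //; apply: (subsetP T1C).
have C3 : #|V| - 3 < #|C|.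
  rewrite ltnNge; apply: contraNN neq => C3.
  have e1 : T1 == C by rewrite eqEcard T1C c1.
  have e2 : T2 == C by rewrite eqEcard T2C c2.
  by rewrite (eqP e1) (eqP e2).
have [z zC] : exists z, z \notin C.
  apply/existsP; rewrite -negb_forall; apply: contra_notN ncon => /forallP h a b.
  have := h a; have := h b; rewrite !inE => xb xa; apply: connect_trans xb.
  by rewrite (sym_connect_sym sym).
have [dz|dz] := posnP (deg g z); first by left; exists z.
have [y] : exists y, y \in nb g z by apply/card_gt0P.
rewrite inE => zy; have yC : y \notin C.
  by apply: contraNN zC => yC; apply: clC yC _; rewrite sym.
have yz : y != z by apply: contraTneq zy => ->; rewrite irr.
have sub : [set z; y] \subset ~: C by rewrite subUset !sub1set !in_setC yC zC.
have cCc : #|C| + #|~: C| = #|V| by rewrite cardsC.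
have c2' : #|[set z; y]| = 2 by rewrite cards2 eq_sym yz.
have := subset_leq_card sub; rewrite c2' => le2.
have [cC2 cC2'] : #|C| = #|V| - 2 /\ #|~: C| = 2.
  by move: cCc le2 C3 n7; clear; move: #|C| #|~: C| #|V| => p q r *; lia.
right; exists C, z, y; split=> //.
by apply/eqP; rewrite eq_sym eqEcard sub c2' cC2'.
Qed.

End Connectivity.

(** * Consequences of equal decks *)

(** The binomials are nonzero up to [M], so agreement at three places gives the quadratic three
    roots and makes it vanish; its constant coefficient is the difference at 0. *)
Lemma three_zeros M (a b : nat -> nat) i j k :
  (forall e, e + 3 <= M -> moment M a e = moment M b e) ->
  i < j -> j < k -> k <= M -> a i = b i -> a j = b j -> a k = b k -> a 0 = b 0.
Proof.
move=> eqm ij jk kM ai aj ak; have [al [be [ga qE]]] := moments_quadratic eqm.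
have zero l : l <= M -> a l = b l -> (al + be * l%:R + ga * l%:R ^+ 2 = 0)%R.
  move=> lM al_bl; have := qE l lM; rewrite al_bl subrr => /esym /eqP.
  rewrite !mulf_eq0 signr_eq0 pnatr_eq0 -leqn0 leqNgt bin_gt0 lM /=.
  by move/eqP.
have zi := zero i (ltac:(lia)) ai; have zj := zero j (ltac:(lia)) aj; have zk := zero k kM ak.
have neq l m : l < m -> (m%:R - l%:R != 0 :> rat)%R by move=> lm; rewrite subr_eq0 eqr_nat gtn_eqF.
have al0 : al = 0%R.
  apply: (mulfI (mulf_neq0 (mulf_neq0 (neq _ _ ij) (neq _ _ jk)) (neq _ _ (ltn_trans ij jk)))).
  rewrite mulr0.
  move: zi zj zk; move: (i%:R)%R (j%:R)%R (k%:R)%R => x y z.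
  clear => zi zj zk.
  (* Lagrange extrapolation to 0, multiplied by the Vandermonde product. *)
  have -> : ((y - x) * (z - y) * (z - x) * al =
    y * z * (z - y) * (al + be * x + ga * x ^+ 2) - x * z * (z - x) * (al + be * y + ga * y ^+ 2)
    + x * y * (y - x) * (al + be * z + ga * z ^+ 2))%R by ring.
  by rewrite zi zj zk !mulr0 subr0 addr0.
have := qE 0 isT; rewrite al0 mulr0 expr0n mulr0 !addr0 mulr0 => /eqP.
by rewrite subr_eq0 eqr_nat => /eqP.
Qed.

Section Volume.
Variables (V : finType) (g : rel V).
Hypotheses (irr : irreflexive g) (sym : symmetric g).

Lemma vol_setT : vol g [set: V] = \sum_x deg g x.
Proof.
by rewrite /vol; apply: eq_big => [x|x _]; rewrite ?inE // /degin setTI.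
Qed.

Lemma vol_degcount : 0 < #|V| -> vol g [set: V] = \sum_(i < #|V|) degcount g i * i.
Proof.
move=> V0; rewrite vol_setT (sum_by_value id (M := #|V|.-1)) => [|x _]; last exact: deg_lt.
by rewrite prednK.
Qed.

Lemma vol_add (Y : {set V}) a b : b \notin Y -> a \in Y -> g a b ->
  vol g Y + 2 <= vol g (b |: Y).
Proof.
move=> bY aY ab; rewrite /vol big_setU1 //= addn2 -add1n leq_add //.
  by apply/card_gt0P; exists a; rewrite !inE aY orbT sym.
have mono x : degin g Y x <= degin g (b |: Y) x.
  by apply: subset_leq_card; apply: setSI; apply: subsetUr.
rewrite (bigD1 a) // [X in _ < X](bigD1 a) //= -addSn leq_add //; last exact: leq_sum.
apply: proper_card; apply/properP; split; first by apply: setSI; apply: subsetUr.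
by exists b; rewrite !inE ?eqxx ?ab ?(negbTE bY).
Qed.

(** Each vertex outside [Y] can be absorbed along an edge leaving the set reached so far, which
    raises the volume by at least 2. In particular every nonempty card of a connected graph lacks at
    least three edges. *)
Lemma vol_connected (Y : {set V}) x : (forall x y, connect g x y) -> x \in Y ->
  vol g Y + 2 * #|~: Y| <= vol g [set: V].
Proof.
move=> cg; move: {2}#|~: Y| (erefl #|~: Y|) => m; elim: m Y => [|m IH] Y.
  by move/eqP; rewrite cards_eq0 => /eqP Y0; rewrite -[Y in vol g Y]setCK Y0 setC0 cards0 addn0.
move=> cY xY; have [y] : exists y, y \in ~: Y by apply/card_gt0P; rewrite cY.
rewrite inE => yY; have [a [b [aY bY ab]]] := connect_exit (cg x y) xY yY.
have := vol_add bY aY ab; have cbY : #|~: (b |: Y)| = m.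
  by move: cY; rewrite (cardsD1 b) inE bY setCU setIC setDE add1n => -[].
have := IH (b |: Y) cbY; rewrite !inE xY orbT => /(_ isT); rewrite cbY cY; lia.
Qed.

End Volume.

Section Deck.
Variable n : nat.
Hypothesis n7 : 7 <= n.
Variables G H : rel 'I_n.
Hypotheses (sG : simple_graph G) (sH : simple_graph H).
Hypothesis GH : same_deck (n - 3) G H.

Lemma deck_degcount e : e + 3 <= n.-1 ->
  moment n.-1 (degcount G) e = moment n.-1 (degcount H) e.
Proof.
move=> en; have [irrG _] := sG; have [irrH _] := sH.
have := degcount_moment (k := n - 3) (e := e) irrG; have := degcount_moment (k := n - 3) (e := e) irrH.
rewrite card_ord => <-; [|lia..]; move=> <-; [|lia..].
by apply: deck_sum GH _ => // S T _ iso /=; rewrite (degin_count_iso iso).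
Qed.

Lemma deck_p3count e : e + 3 <= n - 3 ->
  moment (n - 3) (p3count G) e = moment (n - 3) (p3count H) e.
Proof.
move=> en; have [irrG _] := sG; have [irrH _] := sH.
have := p3_moment (k := n - 3) (e := e) irrG; have := p3_moment (k := n - 3) (e := e) irrH.
rewrite card_ord => <-; [|lia..]; move=> <-; [|lia..].
by apply: deck_sum GH _ => // S T _ iso /=; rewrite (p3_count_iso iso).
Qed.

Lemma deck_pred (P Q : pred {set 'I_n}) :
  (forall S T, card_iso G H S T -> P S = Q T) ->
  #|[set S : {set 'I_n} | (#|S| == n - 3) && P S]| =
  #|[set S : {set 'I_n} | (#|S| == n - 3) && Q S]|.
Proof.
move=> PQ.
have h (R : pred {set 'I_n}) : #|[set S : {set 'I_n} | (#|S| == n - 3) && R S]| =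
    \sum_(S : {set 'I_n} | #|S| == n - 3) R S.
  rewrite -sum1_card big_mkcond [RHS]big_mkcond; apply: eq_bigr => S _.
  by rewrite inE; case: eqP => //=; case: (R S).
by rewrite !h; apply: deck_sum GH _ => // S T _ i; rewrite (PQ S T).
Qed.

Lemma deck_conn :
  #|[set S : {set 'I_n} | (#|S| == n - 3) && conn G S]| =
  #|[set S : {set 'I_n} | (#|S| == n - 3) && conn H S]|.
Proof. by apply: deck_pred => S T; apply: conn_iso. Qed.

Hypothesis cG : connected_graph G.

Lemma connected_no_isolated : degcount G 0 = 0.
Proof.
apply/eqP; rewrite cards_eq0; apply/eqP/setP => x; rewrite !inE; apply/negbTE.
rewrite -lt0n; have [y neq] : exists y, y != x.
  have x0 := ltn_ord x; case: (eqVneq x (Ordinal (ltac:(lia) : 0 < n))) => [->|].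
    by exists (Ordinal (ltac:(lia) : 1 < n)).
  by rewrite eq_sym; exists (Ordinal (ltac:(lia) : 0 < n)).
have [||a [b [/set1P -> _ xb]]] := connect_exit (X := [set x]) (cG x y).
- exact: set11.
- by rewrite inE.
- by apply/card_gt0P; exists b; rewrite inE.
Qed.

Lemma deck_two_conn : 1 < #|[set S : {set 'I_n} | (#|S| == n - 3) && conn H S]|.
Proof.
rewrite -deck_conn ltnNge; apply/negP => /card_le1P le1.
have x0 : 'I_n by exists 0; lia.
have [|S [_ cS connS]] := conn_exists (proj2 sG) (m := n - 3) x0 cG; first by rewrite card_ord; lia.
have [y yS] : exists y, y \notin S.
  apply/existsP; rewrite -negb_forall; apply/negP => /forallP h.
  have : #|S| = n by rewrite -[RHS](card_ord n); apply: eq_card => z; rewrite h.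
  by rewrite cS; lia.
have [|T [yT cT connT]] := conn_exists (proj2 sG) (m := n - 3) y cG; first by rewrite card_ord; lia.
have /le1 /(_ T) : S \in [set S : {set 'I_n} | (#|S| == n - 3) && conn G S] by rewrite inE cS eqxx.
by rewrite !inE cT eqxx connT => /esym /eqP e; rewrite -e yT in yS.
Qed.

(** * One large component and one single edge *)

Section EdgeComponent.
Variables (C : {set 'I_n}) (b1 b2 : 'I_n).
Hypotheses (cC : #|C| = n - 2) (connC : conn H C) (Cc : ~: C = [set b1; b2]) (Hb : H b1 b2).
Hypothesis clC : forall a b, a \in C -> H a b -> b \in C.

Lemma notin_component x : (x \notin C) = (x == b1) || (x == b2).
Proof. by rewrite -in_setC Cc !inE. Qed.

Lemma nb_outside x : x \notin C -> nb H x = if x == b1 then [set b2] else [set b1].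
Proof.
have [irr sym] := sH; move=> xC; apply/setP=> y.
have : H x y -> (y == b1) || (y == b2).
  by move=> xy; rewrite -notin_component; apply: contraNN xC => yC; apply: clC yC _; rewrite sym.
have b12 : b1 != b2 by apply: contraTneq Hb => ->; rewrite irr.
move: xC; rewrite notin_component inE => /orP [/eqP ->|/eqP ->].
  rewrite eqxx inE; case: (eqVneq y b1) => [->|yb1]; first by rewrite irr (negbTE b12).
  case: (eqVneq y b2) => [->|yb2]; first by rewrite Hb.
  by case: (H b1 y) => // /(_ isT).
rewrite [b2 == b1]eq_sym (negbTE b12) inE; case: (eqVneq y b2) => [->|yb2]; first by rewrite irr eq_sym (negbTE b12).
case: (eqVneq y b1) => [->|yb1]; first by rewrite sym Hb.
by case: (H b2 y) => // /(_ isT).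
Qed.

Lemma deg_outside x : x \notin C -> deg H x = 1.
Proof. by move=> xC; rewrite /deg nb_outside //; case: ifP; rewrite cards1. Qed.

Lemma deg_component_le x : deg H x <= n - 3.
Proof.
have [irr sym] := sH; have [xC|xC] := boolP (x \in C); last by rewrite deg_outside //; lia.
have : nb H x \subset C :\ x.
  apply/subsetP=> y; rewrite !inE => xy; rewrite (clC xC xy) andbT.
  by apply: contraTneq xy => ->; rewrite irr.
move/subset_leq_card => le; apply: leq_trans le _.
by have := cardsD1 x C; rewrite xC cC add1n; move: #|C :\ x| => q; clear; lia.
Qed.

Lemma degcount_big i : n - 3 < i -> degcount H i = 0.
Proof.
move=> ni; apply/eqP; rewrite cards_eq0; apply/eqP/setP => x; rewrite !inE.
by apply/negbTE; have := deg_component_le x; lia.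
Qed.

Hypothesis noiso : degcount H 0 = 0.

Lemma deck_degcount_eq i : degcount G i = degcount H i.
Proof.
have [irrG _] := sG; have [irrH _] := sH.
have [ni|ni] := ltnP i n; last first.
  have big (g : rel 'I_n) : irreflexive g -> degcount g i = 0.
    move=> irr; apply/eqP; rewrite cards_eq0; apply/eqP/setP => x; rewrite !inE.
    by apply/negbTE; have := deg_lt irr x; rewrite card_ord; lia.
  by rewrite !big.
apply/esym; apply: (no_isolated_counts n7) ni => //.
- by have := sum_degcount irrH; rewrite card_ord.
- by have := sum_degcount irrG; rewrite card_ord.
- by move=> e en; rewrite -deck_degcount.
- exact: connected_no_isolated.
- by apply: degcount_big; lia.
- by apply: degcount_big; lia.
Qed.

Lemma deck_vol : vol G setT = vol H setT.
Proof.
have [irrG _] := sG; have [irrH _] := sH.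
have n0 : 0 < #|'I_n| by rewrite card_ord; lia.
by rewrite !vol_degcount //; apply: eq_bigr => i _; rewrite deck_degcount_eq.
Qed.

Lemma conn_minus_leaf v v' : v \in C -> nb H v = [set v'] -> conn H (C :\ v).
Proof.
have [irr sym] := sH; move=> vC nbv.
have vv' : H v v' by have := set11 v'; rewrite -nbv inE.
have neq : v' != v by apply: contraTneq vv' => ->; rewrite irr.
have v'C : v' \in C by apply: clC vC vv'.
have [|||//|Y v'Y YS|T [_ TS cT connT]] :=
  @conn_grow _ H sym (C :\ v) [set v'] #|C :\ v|.
- exact: conn1.
- by rewrite sub1set !inE neq.
- by rewrite cards1; apply/card_gt0P; exists v'; rewrite !inE neq.
- have [YS' [y yS yY]] := properP YS.
  have v'inY : v' \in Y by rewrite -sub1set.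
  have v'Y' : v' \in v |: Y by rewrite !inE v'inY orbT.
  have yY' : y \notin v |: Y by move: yS; rewrite !inE (negbTE yY) orbF => /andP [].
  have yC : y \in C by move: yS; rewrite inE => /andP [].
  (* Adding [v] to the set ensures that a path through the leaf does not count as leaving it: the
     only neighbour of [v] already lies in [Y], so the exit edge starts in [Y]. *)
  have [a [b [+ + /and3P [ab aC bC]]]] := connect_exit (connP _ _ connC _ _ v'C yC) v'Y' yY'.
  rewrite !inE negb_or => /orP [/eqP av|aY] /andP [bv bY].
    have : b \in nb H v by rewrite inE -av.
    by rewrite nbv => /set1P bv'; rewrite bv' v'inY in bY.
  by exists a, b; rewrite !inE bv bY bC.
suff -> : C :\ v = T by [].
by apply/eqP; rewrite eq_sym eqEcard TS cT leqnn.
Qed.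

(** Only the edges [b1 b2] and [v v'] are lost. In the sum of degrees, the deleted leaves [v], [b1],
    [b2] account for 3 and the neighbour [v'] for 1. *)
Lemma vol_minus_leaf v v' : v \in C -> nb H v = [set v'] ->
  vol H setT <= vol H (C :\ v) + 4.
Proof.
have [irr sym] := sH; move=> vC nbv.
have degv : deg H v = 1 by rewrite /deg nbv cards1.
rewrite vol_setT (bigID (mem (C :\ v))) /=.
have -> : \sum_(x | x \notin C :\ v) deg H x = 3.
  have -> : 3 = #|~: (C :\ v)|.
    have := cardsD1 v C; rewrite vC cC add1n [#|~: _|]cardsCs setCK card_ord.
    by move: n7 #|_ :\ _|; clear; lia.
  rewrite -sum1_card; apply: eq_big => [x|x]; first by rewrite in_setC.
  by rewrite !inE negb_and negbK => /orP [/eqP -> //|/deg_outside].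
rewrite (_ : forall q, q + 4 = q + 1 + 3) => [|q]; last by rewrite -addnA.
rewrite leq_add2r.
have -> : vol H (C :\ v) + 1 = \sum_(x in C :\ v) (degin H (C :\ v) x + (x == v')).
  rewrite big_split /=; congr (_ + _).
  have v'S : v' \in C :\ v.
    have vv' : H v v' by have := set11 v'; rewrite -nbv inE.
    by rewrite !inE (clC vC vv') andbT; apply: contraTneq vv' => ->; rewrite irr.
  by rewrite (bigD1 v') //= eqxx big1 // => x /andP [_ /negbTE ->].
apply: leq_sum => x; rewrite !inE => /andP [xv xC].
rewrite /deg (cardsD1 v) addnC leq_add //; last first.
  by rewrite inE sym; case vx: (H v x) => //; have : x \in nb H v by [rewrite inE]; rewrite nbv inE => ->.
apply: subset_leq_card; apply/subsetP => y; rewrite !inE => /andP [yv xy].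
by rewrite yv xy (clC xC xy).
Qed.

(** Deleting [b1], [b2] and a leaf of [C] would leave a connected card lacking only two edges. Every
    card of the connected [G] lacks at least three edges, that is, 6 in volume, and the two graphs
    have the same volume. *)
Lemma no_leaf_component v : v \in C -> deg H v != 1.
Proof.
move=> vC; apply/negP => /cards1P [v' nbv].
have := @deck_pred (fun S => conn G S && (vol H setT < vol G S + 6))
                   (fun S => conn H S && (vol H setT < vol H S + 6)).
have PQ S T : card_iso G H S T -> conn G S && (vol H setT < vol G S + 6) =
    conn H T && (vol H setT < vol H T + 6).
  by move=> iso; rewrite (conn_iso iso) (vol_iso iso).
move=> /(_ PQ).
rewrite (_ : [set _ | _] = set0) ?cards0; last first.
  apply/setP=> S; rewrite !inE; apply/negP => /and3P [/eqP cS _].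
  have [x xS] : exists x, x \in S by apply/card_gt0P; rewrite cS; lia.
  have := vol_connected (proj2 sG) cG xS; rewrite deck_vol cardsCs setCK card_ord cS.
  by move: n7; clear; lia.
move=> /esym /eqP; rewrite cards_eq0 => /eqP /setP /(_ (C :\ v)); rewrite !inE.
rewrite (conn_minus_leaf vC nbv) /=.
have := cardsD1 v C; rewrite vC cC add1n => e.
have -> /= : #|C :\ v| == n - 3 by apply/eqP; move: e; clear; move: #|C :\ v| => q; lia.
by have := vol_minus_leaf vC nbv; move: (vol _ _) (vol _ _) => p q; clear; lia.
Qed.

Lemma degcount_leaves : degcount G 1 = 2.
Proof.
have [irr sym] := sH; rewrite deck_degcount_eq /degcount.
have b12 : b1 != b2 by apply: contraTneq Hb => ->; rewrite irr.
rewrite (_ : [set _ | _] = [set b1; b2]) ?cards2 ?b12 // -Cc.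
apply/setP=> x; rewrite !inE; have [xC|xC] := boolP (x \in C).
  exact: negbTE (no_leaf_component xC).
by rewrite deg_outside.
Qed.

Lemma p3count_deg0 (g : rel 'I_n) i : degcount g i.+1 = 0 -> p3count g i = 0.
Proof.
move=> /eqP; rewrite cards_eq0 => /eqP /setP h; apply/eqP; rewrite cards_eq0.
apply/eqP/setP => t; rewrite !inE; have := h t.1.1; rewrite !inE => ->.
exact: andbF.
Qed.

(** The only leaves of [H] are [b1] and [b2], and their component is too small to contain a path on
    three vertices. *)
Lemma p3count_leaf_component : p3count H 0 = 0.
Proof.
have [irr sym] := sH; apply/eqP; rewrite cards_eq0; apply/eqP/setP => -[[u v] w]; rewrite !inE /=.
apply/negP => /andP [/and4P [/= uv vw nuw neq] du].
have uC : u \notin C by apply: contraTN du => uC; apply: no_leaf_component.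
have vC : v \notin C.
  by apply: contraNN uC => vC; apply: clC vC _; rewrite sym.
have : w \in nb H v by rewrite inE.
have : u \in nb H v by rewrite inE sym.
rewrite nb_outside //; case: ifP => _ /set1P eu /set1P ew; by rewrite eu ew eqxx in neq.
Qed.

(** A leaf [u] exists, and by connectedness its neighbour [v] has a further neighbour, which starts
    no edge back to [u]. *)
Lemma p3count_leaf_connected : 0 < p3count G 0.
Proof.
have [irr sym] := sG.
have [u] : exists u, u \in [set x | deg G x == 1].
  by apply/card_gt0P; have := degcount_leaves; rewrite /degcount => ->.
rewrite inE => du; have /cards1P [v nbu] := du.
have uv : G u v by have := set11 v; rewrite -nbu inE.
have [y yuv] : exists y, y \notin [set u; v].
  apply/existsP; rewrite -negb_forall; apply/negP => /forallP h.
  have : #|[set u; v]| = n by rewrite -[RHS](card_ord n); apply: eq_card => z; rewrite h.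
  by have := cards2 u v; case: (u == v) => -> /=; lia.
have [|a [b [+ + ab]]] := connect_exit (X := [set u; v]) (cG u y) _ yuv; first by rewrite !inE eqxx.
rewrite !inE negb_or => /orP [] /eqP ea /andP [bu bv]; rewrite ea {a ea} in ab.
  by have : b \in nb G u by [rewrite inE]; rewrite nbu inE (negbTE bv).
apply/card_gt0P; exists (u, v, b); rewrite inE /= du andbT /p3 /= uv ab eq_sym bu andbT /=.
by apply: contraNN bv => ub; have : b \in nb G u by [rewrite inE]; rewrite nbu => /set1P ->.
Qed.

(** Degree n - 2 does not occur. If n - 3 and n - 4 did not occur either, the path counts of both
    graphs would vanish at the indices n - 3, n - 4 and n - 5, so they would agree at 0, contrary to
    the two preceding lemmas. *)
Lemma exists_large_degree : exists w, deg G w = n - 3 \/ deg G w = n - 4.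
Proof.
have [e|] := posnP (degcount G (n - 3)); last first.
  by case/card_gt0P => w; rewrite inE => /eqP; exists w; left.
have [e'|] := posnP (degcount G (n - 4)); last first.
  by case/card_gt0P => w; rewrite inE => /eqP; exists w; right.
have p3eq i : degcount G i.+1 = 0 -> p3count G i = p3count H i.
  by move=> d; rewrite !p3count_deg0 -?deck_degcount_eq.
have := @three_zeros (n - 3) (p3count G) (p3count H) (n - 5) (n - 4) (n - 3) deck_p3count.
have -> : p3count G (n - 5) = p3count H (n - 5).
  by apply: p3eq; rewrite -e'; congr degcount; lia.
have -> : p3count G (n - 4) = p3count H (n - 4).
  by apply: p3eq; rewrite -e; congr degcount; lia.
have -> : p3count G (n - 3) = p3count H (n - 3).
  by apply: p3eq; rewrite deck_degcount_eq degcount_big //; lia.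
rewrite p3count_leaf_component => h; have := p3count_leaf_connected.
by rewrite h //; lia.
Qed.

(** A connected card is too large to avoid [C], so it lies inside [C] and omits exactly one of its n
    - 2 vertices. *)
Lemma conn_count_component :
  #|[set S : {set 'I_n} | (#|S| == n - 3) && conn H S]| <= n - 2.
Proof.
have <- : 'C(#|C|, n - 3) = n - 2.
  by rewrite cC (_ : n - 3 = n - 2 - 1) ?bin_sub ?bin1 //; move: n7; clear; lia.
rewrite -cards_draws; apply: subset_leq_card; apply/subsetP => S; rewrite !inE.
case/andP => cS connS; rewrite cS andbT.
have [x xSC] : exists x, x \in S :&: C.
  apply/card_gt0P; have := max_card (mem (S :|: C)); rewrite cardsU card_ord (eqP cS) cC.
  by move: n7; clear; move: #|_ :&: _| => q; lia.
have /setIP [xS xC] := xSC; exact: conn_sub_closed connS xS xC clC.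
Qed.

End EdgeComponent.
End Deck.

(** * A vertex of large degree forces many connected cards *)

Section Families.
Variable V : finType.
Implicit Types (B U Z : {set V}) (X Y : {set {set V}}).

(** Meant as sets of deleted vertices: all of [B] and [j] further vertices from [U]. *)
Definition fam B U j := [set B :|: P | P in [set P : {set V} | P \subset U & #|P| == j]].

Lemma card_fam B U j : [disjoint B & U] -> #|fam B U j| = 'C(#|U|, j).
Proof.
move=> dBU; rewrite -cards_draws card_in_imset // => P Q; rewrite !inE.
move=> /andP [PU _] /andP [QU _] e.
have h (Z : {set V}) : Z \subset U -> Z = (B :|: Z) :&: U.
  by move=> ZU; rewrite setIUl (disjoint_setI0 dBU) set0U (setIidPl ZU).
by rewrite (h _ PU) (h _ QU) e.
Qed.

Lemma famP B U j Z : Z \in fam B U j ->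
  exists P : {set V}, [/\ P \subset U, #|P| = j & Z = B :|: P].
Proof. by case/imsetP => P; rewrite inE => /andP [PU /eqP cP] ->; exists P. Qed.

Lemma disjoint_families X Y (x : V) :
  (forall Z, Z \in X -> x \in Z) -> (forall Z, Z \in Y -> x \notin Z) -> [disjoint X & Y].
Proof.
move=> hX hY; rewrite -setI_eq0; apply/eqP/setP => Z; rewrite !inE; apply/negP => /andP [ZX ZY].
by have := hY _ ZY; rewrite hX.
Qed.

Lemma fam_in B U j x Z : x \in B -> Z \in fam B U j -> x \in Z.
Proof. by move=> xB /famP [P [_ _ ->]]; rewrite inE xB. Qed.

Lemma fam_notin B U j x Z : x \notin B -> x \notin U -> Z \in fam B U j -> x \notin Z.
Proof.
move=> xB xU /famP [P [PU _ ->]]; rewrite inE negb_or xB.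
by apply: contraNN xU; apply: (subsetP PU).
Qed.

Lemma card_disjoint2 X Y (W : {set {set V}}) : [disjoint X & Y] -> X \subset W -> Y \subset W ->
  #|X| + #|Y| <= #|W|.
Proof.
move=> d XW YW; have <- : #|X :|: Y| = #|X| + #|Y|.
  by rewrite cardsU (disjoint_setI0 d) cards0 subn0.
by apply: subset_leq_card; rewrite subUset XW.
Qed.

Lemma card_disjoint3 X Y X' (W : {set {set V}}) :
  [disjoint X & Y] -> [disjoint X & X'] -> [disjoint Y & X'] ->
  X \subset W -> Y \subset W -> X' \subset W -> #|X| + #|Y| + #|X'| <= #|W|.
Proof.
move=> d1 d2 d3 XW YW X'W; have <- : #|X :|: Y| = #|X| + #|Y|.
  by rewrite cardsU (disjoint_setI0 d1) cards0 subn0.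
apply: card_disjoint2 => //; last by rewrite subUset XW.
by rewrite -setI_eq0 setIUl (disjoint_setI0 d2) (disjoint_setI0 d3) setU0.
Qed.

(* The filter condition says that [l] is an increasing list of positions in [vs]. *)
Lemma size_named_sets (vs : seq V) (x0 : V) (L : seq (seq nat)) X : uniq vs ->
  uniq L -> all (fun l => [seq i <- iota 0 (size vs) | i \in l] == l) L ->
  (forall l, l \in L -> [set x in [seq nth x0 vs i | i <- l]] \in X) -> size L <= #|X|.
Proof.
move=> uvs uL sL LX; pose enc l := [set x in [seq nth x0 vs i | i <- l]].
pose dec (S : {set V}) := [seq i <- iota 0 (size vs) | nth x0 vs i \in S].
have encK : {in L, cancel enc dec}.
  move=> l lL; have /eqP el := allP sL l lL; rewrite -[RHS]el /dec; apply: eq_in_filter => i.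
  rewrite mem_iota add0n => /andP [_ iv]; rewrite inE; apply/mapP/idP => [[j jl e]|il].
    have jv : j < size vs by move: jl; rewrite -el mem_filter mem_iota => /andP [_ /andP []].
    by move/eqP: e; rewrite nth_uniq // => /eqP ->.
  by exists i.
have u : uniq (map enc L) by rewrite map_inj_in_uniq //; apply: can_in_inj encK.
rewrite -(size_map enc) -(card_uniqP u); apply: subset_leq_card.
by apply/subsetP => S /mapP [l lL ->]; apply: LX.
Qed.

End Families.

Section ManyConnected.
Variables (V : finType) (g : rel V).
Hypotheses (irr : irreflexive g) (sym : symmetric g).
Implicit Types (S T Z P : {set V}).

(** A certificate of connectedness checked by evaluation: each new entry is adjacent to some earlier
    one. *)
Fixpoint linked (prev s : seq V) : bool :=
  if s is x :: s' then has (g x) prev && linked (x :: prev) s' else true.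

Lemma conn_linked x s : linked [:: x] s -> conn g [set y in x :: s].
Proof.
have gen prev : conn g [set y in prev] -> linked prev s -> conn g [set y in s ++ prev].
  elim: s prev => [|z s IH] prev //= cp /andP [/hasP [a ap za] lk].
  have -> : [set y in z :: s ++ prev] = [set y in s ++ z :: prev].
    by apply/setP=> y; rewrite !(inE, mem_cat) orbCA.
  apply: IH => //; have -> : [set y in z :: prev] = z |: [set y in prev].
    by apply/setP=> y; rewrite !inE.
  by apply: (conn_add sym cp (a := a)); rewrite ?inE // sym.
move=> lk; have -> : [set y in x :: s] = [set y in s ++ [:: x]].
  by apply/setP=> y; rewrite !(inE, mem_cat) orbC.
apply: gen lk; have -> : [set y in [:: x]] = [set x] by apply/setP=> y; rewrite !inE.
exact: conn1.
Qed.

(** Connected cards are described by their three deleted vertices, which are easier to enumerate in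
    families. *)
Definition good := [set Z : {set V} | (#|Z| == 3) && conn g (~: Z)].

Lemma card_good : 3 <= #|V| ->
  #|good| = #|[set S : {set V} | (#|S| == #|V| - 3) && conn g S]|.
Proof.
move=> V3; rewrite -(card_imset _ (inv_inj (@setCK V))); apply: eq_card => S.
rewrite inE; apply/imsetP/andP => [[Z]|[/eqP cS connS]].
  by rewrite inE => /andP [/eqP cZ connZ] ->; rewrite cardsCs setCK cZ.
exists (~: S); last by rewrite setCK.
rewrite inE setCK connS andbT cardsCs setCK cS; apply/eqP; lia.
Qed.

Hypothesis cg : forall x y, connect g x y.
Variable w : V.
Let K := nb g w.
Let R := ~: (w |: K).

Lemma memR x : (x \in R) = (x != w) && ~~ g w x.
Proof. by rewrite !inE negb_or. Qed.

Lemma conn_star T : w \in T ->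
  (forall x, x \in T -> x \in R -> exists a, [/\ a \in K, a \in T & g a x]) -> conn g T.
Proof.
move=> wT hT; apply: (conn_root sym (w := w)) => x xT.
have [->|xw] := eqVneq x w; first exact: connect0.
have [wx|wx] := boolP (g w x); first exact: restrict1.
have [|a [aK aT ax]] := hT x xT; first by rewrite memR xw.
by apply: connect_trans (restrict1 _ wT aT) (restrict1 ax aT xT); rewrite inE in aK.
Qed.

Lemma cardR : #|R| = #|V| - (deg g w).+1.
Proof. by rewrite cardsCs setCK cardsU1 inE irr add1n. Qed.

Lemma R_attached : 0 < #|R| -> exists r a, [/\ r \in R, a \in K & g a r].
Proof.
case/card_gt0P => y; rewrite in_setC => yR.
have [|a [r [+ + ar]]] := connect_exit (X := w |: K) (cg w y) _ yR; first by rewrite !inE eqxx.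
rewrite !inE => /orP [/eqP ea|wa]; first by rewrite ea in ar; rewrite ar orbT.
by exists r, a; rewrite !inE.
Qed.

Lemma fam_good (B U : {set V}) j : w \notin B -> U \subset K -> [disjoint B & U] ->
  #|B| + j = 3 ->
  (forall x, x \in R -> x \notin B -> exists a, [/\ a \in K, a \notin B :|: U & g a x]) ->
  fam B U j \subset good.
Proof.
move=> wB UK dBU cB att; apply/subsetP => Z /famP [P [PU cP ->]].
have dBP : [disjoint B & P] by apply: disjointWr dBU.
rewrite inE cardsU (disjoint_setI0 dBP) cards0 subn0 cP cB eqxx /=.
apply: conn_star => [|x].
  rewrite !inE negb_or wB; apply/negP => /(subsetP PU) /(subsetP UK).
  by rewrite inE irr.
rewrite in_setC in_setU negb_or => /andP [xB _] xR; have [a [aK aBU ax]] := att x xR xB.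
exists a; split=> //; rewrite in_setC; apply: contraNN aBU.
by apply: (subsetP (setUS _ PU)).
Qed.

Lemma K_notin_R x : x \in K -> x \notin R.
Proof. by rewrite memR inE => ->; rewrite andbF. Qed.

Lemma sub_R_disjoint_K (B U : {set V}) : B \subset R -> U \subset K -> [disjoint B & U].
Proof.
move=> BR UK; rewrite disjoints_subset; apply/subsetP=> x /(subsetP BR) xR.
by rewrite inE; apply: contraL xR => /(subsetP UK) /K_notin_R.
Qed.

Lemma sub_R_notin_w (B : {set V}) : B \subset R -> w \notin B.
Proof. by move=> BR; apply/negP => /(subsetP BR); rewrite memR eqxx. Qed.

(** Delete both non-neighbours of [w] and any one neighbour, or delete [s] and two neighbours other
    than [a], so that [r] stays attached through [a]. This gives (n - 3) + C(n-4, 2) deletions. *)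
Lemma many_conn_codeg2 : 7 <= #|V| -> deg g w = #|V| - 3 -> #|V| - 1 <= #|good|.
Proof.
move=> n7 dw; have cR : #|R| = 2 by rewrite cardR dw; lia.
have [|r [a [rR aK ar]]] := R_attached; first by rewrite cR.
have [s Rs] : exists s, R :\ r = [set s].
  by apply/cards1P; have := cardsD1 r R; rewrite rR cR => /eqP; rewrite eqSS eq_sym.
have [sr sR] : s != r /\ s \in R by apply/andP; have := set11 s; rewrite -Rs in_setD1.
have Rrs x : x \in R -> x = r \/ x = s.
  move=> xR; have [|xr] := eqVneq x r; [by left|right; apply/set1P].
  by rewrite -Rs in_setD1 xr.
have U1 : K :\ a \subset K by apply: subD1set.
have B1 : [set r; s] \subset R by rewrite subUset !sub1set rR sR.
have B2 : [set s] \subset R by rewrite sub1set.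
have cK : #|K| = #|V| - 3 := dw.
have cKa : #|K :\ a| = #|V| - 4.
  by have := cardsD1 a K; rewrite aK cK add1n; move: #|_ :\ _| #|V| => q m; clear; lia.
have f1 : fam [set r; s] K 1 \subset good.
  apply: fam_good => //; first exact: sub_R_notin_w.
  - exact: sub_R_disjoint_K.
  - by rewrite cards2 eq_sym sr.
  - by move=> x /Rrs [] ->; rewrite !inE eqxx ?orbT.
have f2 : fam [set s] (K :\ a) 2 \subset good.
  apply: fam_good => //; first exact: sub_R_notin_w.
  - exact: sub_R_disjoint_K.
  - by rewrite cards1.
  - move=> x /Rrs [] ->; last by rewrite inE eqxx.
    move=> _; exists a; split=> //; rewrite !inE eqxx orbF.
    by apply: contraTneq aK => ->; apply: contraL sR => /K_notin_R.
have d : [disjoint fam [set r; s] K 1 & fam [set s] (K :\ a) 2].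
  apply: (disjoint_families (x := r)) => Z; first by apply: fam_in; rewrite !inE eqxx.
  apply: fam_notin; first by rewrite inE eq_sym.
  by rewrite inE negb_and; apply/orP; right; apply: contraL rR => /K_notin_R.
have := card_disjoint2 d f1 f2; rewrite !card_fam ?sub_R_disjoint_K // cK cKa bin1.
apply: leq_trans; move: n7; clear; case: #|V| => [|[|[|[|[|[|[|m]]]]]]] // _.
by rewrite !subSS !subn0 !binS !bin0 !bin1; lia.
Qed.

(** * A vertex with exactly three non-neighbours *)

Section Codegree3.
Hypotheses (n7 : 7 <= #|V|) (dw : deg g w = #|V| - 4).
Hypothesis leaves : degcount g 1 = 2.

(** Either a second vertex of [R] has a neighbour in [K], or [r] is the only one that does; then
    some vertex [s] of [R] hangs on [r], because the graph is connected. *)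
Lemma codegree3_cases : exists r a s t,
  [/\ r \in R, a \in K, g a r, uniq [:: r; s; t] & R = [set r; s; t]] /\
  ((exists b, b \in K /\ g b s) \/
   [/\ g r s, forall b, b \in K -> ~~ g b s & forall b, b \in K -> ~~ g b t]).
Proof.
have cR : #|R| = 3 by rewrite cardR dw; lia.
have [|r [a [rR aK ar]]] := R_attached; first by rewrite cR.
have cRr : #|R :\ r| = 2 by have := cardsD1 r R; rewrite rR cR => -[].
have fin s : s \in R :\ r -> exists t, uniq [:: r; s; t] /\ R = [set r; s; t].
  move=> sR; have [t Rt] : exists t, R :\ r :\ s = [set t].
    by apply/cards1P; have := cardsD1 s (R :\ r); rewrite sR cRr => /eqP; rewrite eqSS eq_sym.
  exists t; have : t \in R :\ r :\ s by rewrite Rt set11.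
  move: sR; rewrite !in_setD1 => /andP [sr sR] /and3P [ts tr tR]; split.
    by rewrite /= !inE negb_or eq_sym sr eq_sym tr eq_sym ts.
  by rewrite -setUA -Rt setD1K ?setD1K // in_setD1 sr.
have [/exists_inP [s sR /exists_inP [b bK bs]]|/exists_inPn none] :=
  boolP [exists s in R :\ r, exists b in K, g b s].
  have [t [u eR]] := fin s sR.
  by exists r, a, s, t; split; [split|left; exists b].
have [y] : exists y, y \in R :\ r by apply/card_gt0P; rewrite cRr.
rewrite in_setD1 => /andP [yr yR].
have nb_none s b : s \in R :\ r -> b \in K -> ~~ g b s.
  by move=> sR bK; have /exists_inPn := none s sR; apply.
have [||x [s [+ + xs]]] := connect_exit (X := r |: (w |: K)) (cg w y).
- by rewrite !inE eqxx orbT.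
- by rewrite inE negb_or inE yr -in_setC.
rewrite in_setU1 => xX; rewrite in_setU1 negb_or -[s \notin _]in_setC => /andP [sr sR].
have sR' : s \in R :\ r by rewrite in_setD1 sr.
have [t [u eR]] := fin s sR'.
exists r, a, s, t; split; [by split|right; split].
- case/orP: xX => [/eqP <- //|]; rewrite in_setU1 => /orP [/eqP xw|xK].
    by move: sR; rewrite memR -xw xs andbF.
  by have := nb_none s x sR' xK; rewrite xs.
- by move=> b; apply: nb_none.
- move=> b; apply: nb_none; rewrite in_setD1 eR !inE eqxx orbT andbT.
  by move: u; rewrite /= !inE negb_or => /and3P [/andP [_ rt] _ _]; rewrite eq_sym.
Qed.

(** Deleting all of [R], or two of its vertices and one of [K] so that the third stays attached,
    gives 1 + 2(n - 5) connected cards. If [s] hangs on [r] alone, the second family of n - 5 is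
    replaced by deleting [t] and two vertices of [K] other than [a], C(n-5, 2) in number. Both
    totals reach n - 1 exactly from n = 8 on. *)
Lemma many_conn_codeg3_large : 8 <= #|V| -> #|V| - 1 <= #|good|.
Proof.
move=> n8; have [r [a [s [t [[rR aK ar u eR] alt]]]]] := codegree3_cases.
have cK : #|K| = #|V| - 4 := dw.
have cKx x : x \in K -> #|K :\ x| = #|V| - 5.
  move=> xK; have := cardsD1 x K; rewrite xK cK add1n.
  by move: #|_ :\ _| #|V| => q m; clear; lia.
have [rs rt st] : [/\ r != s, r != t & s != t].
  by move: u; rewrite /= !inE negb_or => /and3P [/andP [-> ->] -> _].
have sR : s \in R by rewrite eR !inE eqxx orbT.
have tR : t \in R by rewrite eR !inE eqxx orbT.
have notK x : x \in R -> x \notin K by move=> xR; apply: contraL xR => /K_notin_R.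
have neqK x y : x \in K -> y \in R -> x == y = false.
  by move=> xK yR; apply: contraTF xK => /eqP ->; apply: notK.
have subR (B : {set V}) : B \subset [set r; s; t] -> B \subset R by rewrite eR.
have sKx x : K :\ x \subset K by apply: subD1set.
have f1 : fam [set r; s; t] set0 0 \subset good.
  apply: fam_good; rewrite ?sub0set ?sub_R_notin_w ?subR //.
  - by rewrite -setI_eq0 setI0.
  - by rewrite -setUA cardsU1 cards2 !inE negb_or rs rt st.
  - by move=> x; rewrite eR => ->.
have c1 : #|fam [set r; s; t] set0 0| = 1.
  by rewrite card_fam ?cards0 ?bin0 // -setI_eq0 setI0.
have B2 : [set s; t] \subset R by rewrite subUset !sub1set sR tR.
have f2 : fam [set s; t] (K :\ a) 1 \subset good.
  apply: fam_good => //; rewrite ?sub_R_notin_w ?sub_R_disjoint_K ?cards2 ?st //.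
  move=> x; rewrite eR !inE -orbA => /or3P [] /eqP ->; rewrite ?eqxx ?orbT // => _.
  by exists a; split=> //; rewrite !in_setU in_setD1 !in_set1 eqxx !(neqK a).
have c2 : #|fam [set s; t] (K :\ a) 1| = #|V| - 5.
  by rewrite card_fam ?sub_R_disjoint_K // bin1 cKx.
have d12 : [disjoint fam [set r; s; t] set0 0 & fam [set s; t] (K :\ a) 1].
  apply: (disjoint_families (x := r)) => Z; first by apply: fam_in; rewrite !inE eqxx.
  by apply: fam_notin; rewrite ?in_setD1 ?(negbTE (notK _ rR)) ?andbF // !inE negb_or rs.
case: alt => [[b [bK bs]]|[grs nos _]].
  have B3 : [set r; t] \subset R by rewrite subUset !sub1set rR tR.
  have f3 : fam [set r; t] (K :\ b) 1 \subset good.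
    apply: fam_good => //; rewrite ?sub_R_notin_w ?sub_R_disjoint_K ?cards2 ?rt //.
    move=> x; rewrite eR !inE -orbA => /or3P [] /eqP ->; rewrite ?eqxx ?orbT // => _.
    by exists b; split=> //; rewrite !in_setU in_setD1 !in_set1 eqxx !(neqK b).
  have c3 : #|fam [set r; t] (K :\ b) 1| = #|V| - 5.
    by rewrite card_fam ?sub_R_disjoint_K // bin1 cKx.
  have sn Z : Z \in fam [set r; t] (K :\ b) 1 -> s \notin Z.
    by apply: fam_notin; rewrite ?in_setD1 ?(negbTE (notK _ sR)) ?andbF // !inE negb_or st eq_sym rs.
  have := card_disjoint3 d12 _ _ f1 f2 f3; rewrite c1 c2 c3 => h.
  apply: leq_trans (h _ _).
  - by move: n8; clear; move: #|V| => m; lia.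
  - by apply: (disjoint_families (x := s)) sn => Z; apply: fam_in; rewrite !inE eqxx orbT.
  - by apply: (disjoint_families (x := s)) sn => Z; apply: fam_in; rewrite !inE eqxx.
have B3 : [set t] \subset R by rewrite sub1set.
have d3 : [disjoint [set t] & K :\ a] by apply: sub_R_disjoint_K.
have f3 : fam [set t] (K :\ a) 2 \subset good.
  apply/subsetP => Z /famP [P [PU cP ->]].
  have dP : [disjoint [set t] & P] by apply: disjointWr d3.
  rewrite inE cardsU (disjoint_setI0 dP) cards0 subn0 cP cards1 /=.
  have notP x : x \notin K :\ a -> x \notin P by apply: contraNN; apply: (subsetP PU).
  have sT : s \in ~: ([set t] :|: P).
    by rewrite !inE negb_or st notP // in_setD1 (negbTE (notK _ sR)) andbF.
  rewrite -(setD1K sT); apply: (conn_add sym (a := r)) grs; last first.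
    by rewrite !inE rs negb_or rt notP // in_setD1 (negbTE (notK _ rR)) andbF.
  apply: conn_star => [|x].
    have ws : w != s by apply: contraTneq sR => <-; rewrite memR eqxx.
    have wt : w != t by apply: contraTneq tR => <-; rewrite memR eqxx.
    by rewrite !inE ws negb_or wt notP // !inE irr andbF.
  rewrite in_setD1 in_setC in_setU negb_or in_set1 => /and3P [xs xt _].
  rewrite eR !inE (negbTE xs) (negbTE xt) !orbF => /eqP ->.
  exists a; split=> //; rewrite in_setD1 in_setC in_setU in_set1 !(neqK a) //=.
  by rewrite notP // in_setD1 eqxx.
have c3 : #|fam [set t] (K :\ a) 2| = 'C(#|V| - 5, 2) by rewrite card_fam // cKx.
have sn Z : Z \in fam [set t] (K :\ a) 2 -> s \notin Z.
  by apply: fam_notin; rewrite ?in_setD1 ?(negbTE (notK _ sR)) ?andbF // !inE st.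
have := card_disjoint3 d12 _ _ f1 f2 f3; rewrite c1 c2 c3 => h.
apply: leq_trans (h _ _).
- move: n8; clear; case: #|V| => [|[|[|[|[|[|[|[|m]]]]]]]] // _.
  by rewrite !subSS !subn0 !binS !bin0 !bin1; lia.
- by apply: (disjoint_families (x := s)) sn => Z; apply: fam_in; rewrite !inE eqxx orbT.
- by apply: (disjoint_families (x := s)) sn => Z; apply: fam_in; rewrite !inE eqxx.
Qed.

Lemma deg_two x y z : g x y -> g x z -> y != z -> deg g x != 1.
Proof.
move=> xy xz yz; apply: contraNneq yz => /eqP /cards1P [v e].
have : y \in nb g x by rewrite inE.
have : z \in nb g x by rewrite inE.
by rewrite e => /set1P -> /set1P ->.
Qed.

Lemma deg_one x y : g x y -> (forall z, g x z -> z = y) -> deg g x = 1.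
Proof.
move=> xy h; apply/eqP/cards1P; exists y; apply/setP=> z; rewrite !inE.
by apply/idP/eqP => [/h|->].
Qed.

Definition linked_at (vs : seq V) (l : seq nat) : bool :=
  if [seq nth w vs i | i <- l] is x :: s then linked [:: x] s else false.

Lemma size_linked_sets (vs : seq V) (L : seq (seq nat)) : #|V| = 7 -> uniq vs -> size vs = 7 ->
  uniq L -> all (fun l => [seq i <- iota 0 7 | i \in l] == l) L ->
  all (fun l => (size l == 4) && linked_at vs l) L -> size L <= #|good|.
Proof.
move=> V7 uvs svs uL sL lk; rewrite card_good ?V7 //.
apply: (size_named_sets (vs := vs) (x0 := w)) => //; first by rewrite svs.
move=> l lL; have /eqP el := allP sL l lL; have /andP [/eqP l4 lkl] := allP lk l lL.
rewrite inE; apply/andP; split; last first.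
  move: lkl; rewrite /linked_at; case: [seq _ | _ <- _] => // x s' lks.
  exact: conn_linked.
have ul : uniq [seq nth w vs i | i <- l].
  rewrite map_inj_in_uniq; first by rewrite -el filter_uniq ?iota_uniq.
  move=> i j; rewrite -el !mem_filter !mem_iota -svs => /and3P [_ _ iv] /and3P [_ _ jv] /eqP.
  by rewrite nth_uniq // => /eqP.
by rewrite cardsE (card_uniqP ul) size_map l4.
Qed.

(* The numbers in the lists are positions in [[:: w; a; c; d; r; s; t]], where
   [K = {a, c, d}] and [R = {r, s, t}]. *)
Lemma many_conn_codeg3_7 : #|V| = 7 -> 6 <= #|good|.
Proof.
move=> V7; have [r [a [s [t [[rR aK ar u eR] alt]]]]] := codegree3_cases.
have cK : #|K| = 3 by have := dw; rewrite V7.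
have [rs rt st] : [/\ r != s, r != t & s != t].
  by move: u; rewrite /= !inE negb_or => /and3P [/andP [-> ->] -> _].
have sR : s \in R by rewrite eR !inE eqxx orbT.
have tR : t \in R by rewrite eR !inE eqxx orbT.
have notK x : x \in R -> x \notin K by move=> xR; apply: contraL xR => /K_notin_R.
have neqK x y : x \in K -> y \in R -> x == y = false.
  by move=> xK yR; apply: contraTF xK => /eqP ->; apply: notK.
have neqw x : x \in R -> w == x = false.
  by move=> xR; apply: contraTF xR => /eqP <-; rewrite memR eqxx.
have neqwK x : x \in K -> w == x = false.
  by rewrite inE; apply: contraTF => /eqP <-; rewrite irr.
have Kw x : x \in K -> g x w by rewrite inE sym.
have uvs c d : c \in K -> d \in K -> uniq [:: a; c; d] -> uniq [:: w; a; c; d; r; s; t].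
  move=> cK' dK' u'; rewrite (cat_uniq [:: w; a; c; d] [:: r; s; t]) u andbT /=.
  move: u'; rewrite /= !inE !orbF !negb_or => /and3P [-> -> _].
  by rewrite !neqwK // ![r == _]eq_sym ![s == _]eq_sym ![t == _]eq_sym !neqw // !neqK.
have cKa2 : #|K :\ a| = 2 by have := cardsD1 a K; rewrite aK cK => -[].
have exK c : c \in K :\ a -> exists d, [/\ d \in K, uniq [:: a; c; d] & K = [set a; c; d]].
  move=> cKa; have [d Kd] : exists d, K :\ a :\ c = [set d].
    by apply/cards1P; have := cardsD1 c (K :\ a); rewrite cKa cKa2 => /eqP; rewrite eqSS eq_sym.
  exists d; have : d \in K :\ a :\ c by rewrite Kd set11.
  move: cKa; rewrite !in_setD1 => /andP [ca cK'] /and3P [dc da dK]; split=> //.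
    by rewrite /= !inE negb_or ![a == _]eq_sym ca da eq_sym dc.
  by rewrite -setUA -Kd setD1K ?setD1K // in_setD1 ca.
have [c0 c0K] : exists c, c \in K :\ a.
  by apply/card_gt0P; rewrite cKa2.
have aw := Kw a aK; have ra : g r a by rewrite sym.
have [y ty] : exists y, g t y.
  have [|//|z [y [/set1P -> _ ty]]] := connect_exit (X := [set t]) (cg t w); first exact: set11.
    by rewrite inE neqw.
  by exists y.
have ycase : [\/ y \in K, y = r | y = s].
  have [yK|yK] := boolP (y \in K); first by constructor 1.
  have yw : y != w.
    by apply: contraTneq ty => ->; rewrite sym; move: tR; rewrite memR => /andP [].
  have : y \in R by rewrite memR yw; rewrite inE in yK.
  rewrite eR !inE -orbA => /or3P [] /eqP e; [by constructor 2|by constructor 3|].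
  by rewrite e irr in ty.
case: alt => [[b [bK bs]]|[grs nos not]].
  have sb : g s b by rewrite sym.
  (* If [r] and [s] are both attached to [a], six connected cards avoid [t]. Otherwise five are
     listed that avoid [t], and a sixth is found through the neighbour [y] of [t]. *)
  have [ba|ba] := eqVneq b a.
    have [d [dK u' eK]] := exK c0 c0K.
    have cK' : c0 \in K by move: c0K; rewrite in_setD1 => /andP [].
    have cw := Kw _ cK'; have dw' := Kw _ dK; rewrite ba in sb.
    apply: (size_linked_sets (L := [:: [:: 0; 1; 2; 3]; [:: 0; 1; 2; 4]; [:: 0; 1; 3; 4];
      [:: 0; 1; 2; 5]; [:: 0; 1; 3; 5]; [:: 0; 1; 4; 5]]) V7 (uvs _ _ cK' dK u')) => //.
    by rewrite /linked_at /= !(aw, cw, dw', ra, sb) ?orbT.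
  have bKa : b \in K :\ a by rewrite in_setD1 ba.
  have [d [dK u' eK]] := exK b bKa.
  have bw := Kw _ bK; have dw' := Kw _ dK.
  have five l : l \in [:: [:: 0; 1; 2; 6]; [:: 0; 1; 3; 6]; [:: 0; 1; 4; 6]; [:: 0; 2; 5; 6]] ->
      linked_at [:: w; a; b; d; r; s; t] l -> 6 <= #|good|.
    move=> lL lk.
    apply: (size_linked_sets (L := [:: l; [:: 0; 1; 2; 3]; [:: 0; 1; 2; 4]; [:: 0; 1; 3; 4];
      [:: 0; 1; 2; 5]; [:: 0; 2; 3; 5]]) V7 (uvs _ _ bK dK u')) => //.
    - by move: lL; rewrite !inE => /or4P [] /eqP ->.
    - by move: lL; rewrite !inE => /or4P [] /eqP ->.
    - rewrite [all _ _]/= lk /linked_at /= !(aw, bw, dw', ra, sb) ?orbT ?andbT.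
      by move: lL; rewrite !inE => /or4P [] /eqP ->.
  case: ycase => [|ey|ey].
  - rewrite eK !inE -orbA => /or3P [] /eqP ey; rewrite ey in ty.
    + by apply: (five [:: 0; 1; 2; 6]) => //; rewrite /linked_at /= !(aw, bw, ty) ?orbT.
    + by apply: (five [:: 0; 1; 2; 6]) => //; rewrite /linked_at /= !(aw, bw, ty) ?orbT.
    + by apply: (five [:: 0; 1; 3; 6]) => //; rewrite /linked_at /= !(aw, dw', ty) ?orbT.
  - rewrite ey in ty.
    by apply: (five [:: 0; 1; 4; 6]) => //; rewrite /linked_at /= !(aw, ra, ty) ?orbT.
  - rewrite ey in ty.
    by apply: (five [:: 0; 2; 5; 6]) => //; rewrite /linked_at /= !(bw, sb, ty) ?orbT.
have {}grs : g s r by rewrite sym.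
have [d [dK u' eK]] := exK c0 c0K; move: c0 c0K u' eK => c; rewrite in_setD1 => /andP [ca cK'] u' eK.
have cw := Kw _ cK'; have dw' := Kw _ dK; have U := uvs _ _ cK' dK u'.
(* The edges wa, wc, wd, ar, rs give four connected cards; the attachment of [t] and any further
   edge must supply two more. *)
have four l1 l2 : uniq [:: l1; l2; [:: 0; 1; 2; 3]; [:: 0; 1; 2; 4]; [:: 0; 1; 3; 4]; [:: 0; 1; 4; 5]] ->
    all (fun l => [seq i <- iota 0 7 | i \in l] == l) [:: l1; l2] ->
    all (fun l => (size l == 4) && linked_at [:: w; a; c; d; r; s; t] l) [:: l1; l2] -> 6 <= #|good|.
  move=> uL sL lk.
  apply: (size_linked_sets (L := [:: l1; l2; [:: 0; 1; 2; 3]; [:: 0; 1; 2; 4]; [:: 0; 1; 3; 4];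
    [:: 0; 1; 4; 5]]) V7 U) => //.
  rewrite (all_cat _ [:: l1; l2] [:: [:: 0; 1; 2; 3]; [:: 0; 1; 2; 4]; [:: 0; 1; 3; 4]; [:: 0; 1; 4; 5]]).
  apply/andP; split; [exact: lk|].
  by rewrite /linked_at /= !(aw, cw, dw', ra, grs) ?orbT.
case: (boolP (g t r)) => [tr|ntr].
  by apply: (four [:: 0; 1; 4; 6] [:: 1; 4; 5; 6]); rewrite // /linked_at /= !(aw, ra, grs, tr) ?orbT.
have ts : g t s.
  case: ycase => [yK|ey|ey]; last by rewrite -ey.
    by have := not _ yK; rewrite sym ty.
  by move: ty; rewrite ey (negbTE ntr).
have five l : uniq [:: l; [:: 1; 4; 5; 6]; [:: 0; 1; 2; 3]; [:: 0; 1; 2; 4]; [:: 0; 1; 3; 4]; [:: 0; 1; 4; 5]] ->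
    [seq i <- iota 0 7 | i \in l] == l -> size l = 4 ->
    linked_at [:: w; a; c; d; r; s; t] l -> 6 <= #|good|.
  move=> uL sL l4 lk; apply: (four l [:: 1; 4; 5; 6]) => //; first by apply/and3P; split.
  by rewrite [all _ _]/= l4 lk /linked_at /= !(ra, grs, ts) ?orbT.
case: (boolP (g r c)) => [rc|nrc].
  by apply: (five [:: 0; 2; 4; 5]); rewrite // /linked_at /= !(cw, rc, grs) ?orbT.
case: (boolP (g r d)) => [rd|nrd].
  by apply: (five [:: 0; 3; 4; 5]); rewrite // /linked_at /= !(dw', rd, grs) ?orbT.
case: (boolP (g c a)) => [gca|nca].
  by apply: (five [:: 1; 2; 4; 5]); rewrite // /linked_at /= !(gca, ra, grs) ?orbT.
case: (boolP (g d a)) => [gda|nda].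
  by apply: (five [:: 1; 3; 4; 5]); rewrite // /linked_at /= !(gda, ra, grs) ?orbT.
(* The only edges left are wa, wc, wd, ar, rs, st and possibly cd. There is one leaf if cd is an
   edge and there are three if not, never two. *)
have all7 x : x \in [:: w; a; c; d; r; s; t].
  have : x \in w |: (K :|: R) by rewrite !inE; case: (x == w) => //=; case: (g w x).
  by rewrite eK eR !inE -!orbA.
have [ac ad cd] : [/\ a != c, a != d & c != d].
  by move: u'; rewrite /= !inE negb_or => /and3P [/andP [-> ->] -> _].
have tleaf : deg g t = 1.
  apply: (deg_one ts) => z tz; have := all7 z; rewrite !inE => /or4P [|||/or4P [|||]] /eqP e //.
  - by move: tR; rewrite memR sym -e tz andbF.
  - by have := not a aK; rewrite sym -e tz.
  - by have := not c cK'; rewrite sym -e tz.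
  - by have := not d dK; rewrite sym -e tz.
  - by rewrite -e tz in ntr.
  - by rewrite e irr in tz.
case: (boolP (g c d)) => [gcd|ncd].
  have : [set x | deg g x == 1] \subset [set t].
    apply/subsetP => x; rewrite !inE; have := all7 x; rewrite !inE.
    rewrite sym in gcd *.
    move=> /or4P [|||/or4P [|||]] /eqP -> //.
    - by rewrite (negbTE (deg_two (y := a) (z := c) _ _ _)) // sym.
    - by rewrite (negbTE (deg_two (y := w) (z := r) _ _ _)) // ?neqw // sym.
    - by rewrite (negbTE (deg_two (y := w) (z := d) _ _ _)) // ?neqwK // sym.
    - by rewrite (negbTE (deg_two (y := w) (z := c) _ _ _)) // ?neqwK.
    - by rewrite (negbTE (deg_two (y := a) (z := s) _ _ _)) // ?neqK // sym.
    - by rewrite (negbTE (deg_two (y := r) (z := t) _ _ _)) // sym.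
  by move=> /subset_leq_card; rewrite cards1; have := leaves; rewrite /degcount => ->.
have cleaf : deg g c = 1.
  apply: (deg_one cw) => z cz; have := all7 z; rewrite !inE => /or4P [|||/or4P [|||]] /eqP e //.
  - by rewrite -e cz in nca.
  - by rewrite e irr in cz.
  - by rewrite -e cz in ncd.
  - by rewrite sym -e cz in nrc.
  - by have := nos c cK'; rewrite -e cz.
  - by have := not c cK'; rewrite -e cz.
have dleaf : deg g d = 1.
  apply: (deg_one dw') => z dz; have := all7 z; rewrite !inE => /or4P [|||/or4P [|||]] /eqP e //.
  - by rewrite -e dz in nda.
  - by rewrite sym -e dz in ncd.
  - by rewrite e irr in dz.
  - by rewrite sym -e dz in nrd.
  - by have := nos d dK; rewrite -e dz.
  - by have := not d dK; rewrite -e dz.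
have : [set c; d; t] \subset [set x | deg g x == 1].
  by rewrite !subUset !sub1set !inE cleaf dleaf tleaf.
move/subset_leq_card; have := leaves; rewrite /degcount => ->.
by rewrite -setUA cardsU1 cards2 !inE negb_or cd !(neqK _ t).
Qed.

Lemma many_conn_codeg3 : #|V| - 1 <= #|good|.
Proof.
have [n8|n8] := ltnP 7 #|V|; first exact: many_conn_codeg3_large.
have V7 : #|V| = 7 by apply/eqP; rewrite eqn_leq n8 n7.
by rewrite {1}V7; apply: many_conn_codeg3_7.
Qed.

End Codegree3.
End ManyConnected.

(** * Six vertices *)

Section ThreeDeck.

(** Increasing lists of numbers stand for the three-element subsets, so that the two decks can be
    compared by [vm_compute]. *)
Definition triples : seq (seq nat) :=
  flatten [seq flatten [seq [seq [:: i; j; k] | i <- iota 0 j] | j <- iota 0 k] | k <- iota 0 6].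

Definition named (l : seq nat) : {set 'I_6} := [set x : 'I_6 | (x : nat) \in l].

Lemma triples_sorted : all (fun l => [seq i <- iota 0 6 | i \in l] == l) triples.
Proof. by vm_compute. Qed.

Lemma named_inj : {in triples &, injective named}.
Proof.
have h l : l \in triples -> l = [seq i <- iota 0 6 | inord i \in named l].
  move=> lL; have /eqP {1}<- := allP triples_sorted l lL; apply: eq_in_filter => i.
  by rewrite mem_iota => /andP [_ i6]; rewrite inE inordK.
by move=> l l' lL lL' e; rewrite (h _ lL) (h _ lL') e.
Qed.

Lemma enum_named l : l \in triples -> perm_eq [seq val x | x <- enum (named l)] l.
Proof.
move=> lL; have /eqP el := allP triples_sorted l lL; apply: uniq_perm.
- by rewrite (map_inj_uniq val_inj) enum_uniq.
- by rewrite -el filter_uniq ?iota_uniq.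
move=> i; apply/mapP/idP => [[x]|il]; first by rewrite mem_enum inE => xl ->.
have i6 : i < 6 by move: il; rewrite -el mem_filter mem_iota => /andP [].
by exists (Ordinal i6); rewrite // mem_enum inE.
Qed.

Lemma size_triples l : l \in triples -> size l = 3.
Proof.
have /allP h : all (fun l => size l == 3) triples by vm_compute.
by move=> /h /eqP.
Qed.

Lemma card_named l : l \in triples -> #|named l| = 3.
Proof.
by move=> lL; rewrite cardE -(size_map val) (perm_size (enum_named lL)) size_triples.
Qed.

Lemma count_triples (P : pred {set 'I_6}) :
  #|[set S : {set 'I_6} | (#|S| == 3) && P S]| = count (P \o named) triples.
Proof.
have u : uniq (map named triples).
  by rewrite (map_inj_in_uniq named_inj).
have all3 : [set S : {set 'I_6} | #|S| == 3] =i map named triples.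
  have sub : [set S in map named triples] \subset [set S : {set 'I_6} | #|S| == 3].
    by apply/subsetP => S; rewrite in_set => /mapP [l lL ->]; rewrite in_set card_named.
  (* The list has 20 = C(6, 3) distinct members, so it is complete. *)
  have c : #|[set S : {set 'I_6} | #|S| == 3]| = 20.
    have := cards_draws [set: 'I_6] 3; rewrite cardsT card_ord -[X in _ = X -> _]/20 => <-.
    by apply: eq_card => S; rewrite !inE subsetT.
  have -> : [set S : {set 'I_6} | #|S| == 3] = [set S in map named triples].
    by apply/esym/eqP; rewrite eqEcard sub c cardsE (card_uniqP u) size_map.
  by move=> S; rewrite in_set.
rewrite -count_map -size_filter -(card_uniqP (filter_uniq P u)).
by apply: eq_card => S; rewrite in_set mem_filter andbC -all3 in_set.
Qed.

(** A simple graph on three vertices is three truth values, so quantification over [F] becomes eight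
    evaluations. *)
Definition triple_iso (e : rel nat) (f01 f02 f12 : bool) (l : seq nat) : bool :=
  has (fun p => [&& e (nth 0 p 0) (nth 0 p 1) == f01, e (nth 0 p 0) (nth 0 p 2) == f02
                  & e (nth 0 p 1) (nth 0 p 2) == f12]) (permutations l).

Let i0 : 'I_3 := @Ordinal 3 0 isT.
Let i1 : 'I_3 := @Ordinal 3 1 isT.
Let i2 : 'I_3 := @Ordinal 3 2 isT.

Lemma ord3 (i : 'I_3) : [\/ i = i0, i = i1 | i = i2].
Proof.
case: i => -[|[|[|//]]] i3; [constructor 1|constructor 2|constructor 3]; exact: val_inj.
Qed.

Variable e : rel nat.
Hypotheses (e_irr : irreflexive e) (e_sym : symmetric e).
Let G : rel 'I_6 := fun i j => e i j.

Lemma triple_isoP (F : rel 'I_3) l : simple_graph F -> l \in triples ->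
  induced_iso G F (named l) = triple_iso e (F i0 i1) (F i0 i2) (F i1 i2) l.
Proof.
move=> [Firr Fsym] lL; apply/induced_isoP/hasP => [[f [injf fS Ff]]|[p]].
  exists [seq val (f i) | i <- [:: i0; i1; i2]]; last by rewrite /= !Ff !eqxx.
  rewrite mem_permutations; apply: perm_trans (enum_named lL).
  rewrite (map_comp val f); apply: perm_map; apply: uniq_perm.
  - by rewrite map_inj_uniq.
  - exact: enum_uniq.
  move=> x; rewrite mem_enum -fS; apply/mapP/imsetP => [[i _ ->]|[i _ ->]]; exists i => //.
  by case: (ord3 i) => ->; rewrite !inE eqxx ?orbT.
rewrite mem_permutations => pl /and3P [/eqP e01 /eqP e02 /eqP e12].
have p3 : size p = 3 by rewrite (perm_size pl) size_triples.
have /eqP el := allP triples_sorted l lL.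
have p6 i : i < 3 -> nth 0 p i < 6.
  move=> i3; have : nth 0 p i \in l by rewrite -(perm_mem pl) mem_nth // p3.
  by rewrite -el mem_filter mem_iota => /andP [].
have up : uniq p by rewrite (perm_uniq pl) -el filter_uniq ?iota_uniq.
pose f (i : 'I_3) : 'I_6 := Ordinal (p6 i (ltn_ord i)).
have injf : injective f.
  move=> i j /(congr1 val) /= /eqP; rewrite nth_uniq ?p3 //.
  by move/eqP/val_inj.
exists f; split=> //.
- apply/eqP; rewrite eqEcard card_imset // cardsT card_ord card_named // andbT.
  by apply/subsetP => _ /imsetP [i _ ->]; rewrite inE -(perm_mem pl) mem_nth // p3.
- have s i j : F i j = G (f i) (f j) -> F j i = G (f j) (f i).
    by rewrite Fsym => ->; rewrite /G e_sym.
  move=> i j; case: (ord3 i) => ->; case: (ord3 j) => ->; rewrite ?Firr /G ?e_irr //; apply: s; done.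
Qed.

End ThreeDeck.

Definition path_edge (i j : nat) : bool := (i.+1 == j) || (j.+1 == i).

Definition cycle_plus_edge (i j : nat) : bool :=
  ((i, j) \in [:: (0, 1); (1, 2); (2, 3); (0, 3); (4, 5)]) ||
  ((j, i) \in [:: (0, 1); (1, 2); (2, 3); (0, 3); (4, 5)]).

(** The path on six vertices is compared with a 4-cycle plus a disjoint edge. Both are triangle-free
    with five edges and four induced paths on three vertices, which fixes the number of 3-cards of
    each kind; the code confirms this by evaluation. *)
Lemma sharp_threshold : exists G H : rel 'I_6,
  [/\ simple_graph G, simple_graph H, same_deck 3 G H, connected_graph G & ~ connected_graph H].
Proof.
have Pirr : irreflexive path_edge by move=> i; rewrite /path_edge; lia.
have Psym : symmetric path_edge by move=> i j; rewrite /path_edge orbC.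
have Cirr : irreflexive cycle_plus_edge.
  by move=> i; rewrite /cycle_plus_edge orbb !inE !xpair_eqE; case: i => [|[|[|[|[|[|i]]]]]].
have Csym : symmetric cycle_plus_edge by move=> i j; rewrite /cycle_plus_edge orbC.
exists (fun i j => path_edge i j), (fun i j => cycle_plus_edge i j); split.
- by split=> [i|i j]; [apply: Pirr|apply: Psym].
- by split=> [i|i j]; [apply: Cirr|apply: Csym].
- move=> F sF; rewrite /deck_mult !count_triples.
  rewrite (eq_in_count (a2 := triple_iso path_edge (F (@Ordinal 3 0 isT) (@Ordinal 3 1 isT))
    (F (@Ordinal 3 0 isT) (@Ordinal 3 2 isT)) (F (@Ordinal 3 1 isT) (@Ordinal 3 2 isT)))); last first.
    by move=> l lL; apply: triple_isoP.
  rewrite [RHS](eq_in_count (a2 := triple_iso cycle_plus_edge (F (@Ordinal 3 0 isT) (@Ordinal 3 1 isT))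
    (F (@Ordinal 3 0 isT) (@Ordinal 3 2 isT)) (F (@Ordinal 3 1 isT) (@Ordinal 3 2 isT)))); last first.
    by move=> l lL; apply: triple_isoP.
  by do 3![case: (F _ _)]; vm_compute.
- have step (i : 'I_6) : connect (fun i j : 'I_6 => path_edge i j) ord0 i.
    case: i => m; elim: m => [|m IH] m6; first by rewrite (_ : Ordinal m6 = ord0) //; apply: val_inj.
    apply: connect_trans (IH (ltnW m6)) (connect1 _).
    by rewrite /path_edge /= eqxx.
  move=> x y; apply: connect_trans (step y).
  rewrite (sym_connect_sym (e := fun i j : 'I_6 => path_edge i j)); first exact: step.
  by move=> i j; apply: Psym.
- move=> /(_ ord0 (@Ordinal 6 4 isT)) /connectP [p].
  have h (x : 'I_6) : path (fun i j : 'I_6 => cycle_plus_edge i j) x p -> x < 4 -> last x p < 4.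
    elim: p x => [|y p IH] x //= /andP [xy pth] x4; apply: (IH y pth).
    move: xy x4; case: x => -[|[|[|[|[|[|m]]]]]] //= m6; case: y {IH pth} => -[|[|[|[|[|[|k]]]]]] //=.
  by move=> pth e; have := h ord0 pth isT; rewrite -e.
Qed.

(** * Seven vertices and an isolated vertex *)

Section SevenVertices.
Variables (V : finType) (g : rel V).
Hypotheses (irr : irreflexive g) (sym : symmetric g).
Implicit Types (S Q A B : {set V}).

Definition clique Q := {in Q &, forall x y, x != y -> g x y}.

(** On four vertices, one of them isolated, volume 6 forces a triangle on the other three. *)
Definition triangle_isolated S : bool :=
  (vol g S == 6) && (0 < #|[set x | (x \in S) && (degin g S x == 0)]|).

Lemma degin_lt S x : x \in S -> degin g S x < #|S|.
Proof.
move=> xS; rewrite [X in _ < X](cardsD1 x) xS add1n ltnS; apply: subset_leq_card.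
by apply/subsetP => y; rewrite !inE => /andP [-> xy]; rewrite andbT; apply: contraTneq xy => ->; rewrite irr.
Qed.

Lemma degin_clique Q x : clique Q -> x \in Q -> degin g Q x = #|Q|.-1.
Proof.
move=> cQ xQ; rewrite (cardsD1 x Q) xQ add1n /=; apply: eq_card => y; rewrite !inE.
have [->|yx] := eqVneq y x; first by rewrite irr andbF.
by case yQ: (y \in Q) => //=; rewrite cQ // eq_sym.
Qed.

Lemma vol_clique4 Q : #|Q| = 4 -> clique Q -> vol g Q = 12.
Proof.
move=> Q4 cQ; rewrite /vol (eq_bigr (fun=> 3)) => [|x xQ]; first by rewrite sum_nat_const Q4.
by rewrite degin_clique // Q4.
Qed.

Lemma vol_tight S m x : #|S| = m.+1 -> (forall y, y \in S -> degin g S y <= m) ->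
  vol g S = m * m.+1 -> x \in S -> degin g S x = m.
Proof.
move=> cS le vS xS; apply/eqP; rewrite eqn_leq le //= leqNgt; apply/negP => lt.
have : vol g S < m * m.+1.
  rewrite /vol (big_setD1 x) //=; apply: leq_ltn_trans (_ : _ <= degin g S x + m * m) _.
    rewrite leq_add2l; have -> : m * m = \sum_(y in S :\ x) m.
      by rewrite sum_nat_const; have := cardsD1 x S; rewrite xS cS add1n => -[->].
    by apply: leq_sum => y; rewrite in_setD1 => /andP [_]; apply: le.
  by rewrite mulnS ltn_add2r.
by rewrite vS ltnn.
Qed.

Lemma clique_vol4 Q : #|Q| = 4 -> vol g Q = 12 -> clique Q.
Proof.
move=> Q4 vQ x y xQ yQ xy.
have dx : degin g Q x = 3.
  by apply: (vol_tight (m := 3)) => // z zQ; rewrite -ltnS -Q4; apply: degin_lt.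
have sub : Q :&: nb g x \subset Q :\ x.
  by apply/subsetP => z; rewrite !inE => /andP [-> xz]; rewrite andbT; apply: contraTneq xz => ->; rewrite irr.
have e : Q :&: nb g x = Q :\ x.
  apply/eqP; rewrite eqEcard sub -/(degin g Q x) dx.
  by have := cardsD1 x Q; rewrite xQ Q4 add1n => -[<-].
by have : y \in Q :\ x by [rewrite in_setD1 eq_sym xy]; rewrite -e !inE => /andP [].
Qed.

Lemma deginU1 z A x : ~~ g x z -> degin g (z |: A) x = degin g A x.
Proof.
move=> xz; apply: eq_card => y; rewrite !inE; case: (eqVneq y z) => [->|] //=.
by rewrite (negbTE xz) andbF.
Qed.

Lemma edge_exchange A B : \sum_(u in A) degin g B u = \sum_(v in B) degin g A v.
Proof.
have h (X : {set V}) u : degin g X u = \sum_(v in X) (g u v : nat).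
  rewrite /degin -sum1_card big_mkcond [RHS]big_mkcond; apply: eq_bigr => v _.
  by rewrite !inE; case: (v \in X); case: (g u v).
rewrite (eq_bigr _ (fun u _ => h B u)) exchange_big /=; apply: eq_bigr => v _.
by rewrite h; apply: eq_bigr => u _; rewrite sym.
Qed.

Lemma degin_split A x : deg g x = degin g A x + degin g (~: A) x.
Proof. by rewrite /deg -(cardsID A (nb g x)) setIC setDE [nb g x :&: ~: A]setIC. Qed.

(** The isolated [z] combines with each of the four triangles in [Q]. *)
Lemma many_triangle_isolated z Q : deg g z = 0 -> #|Q| = 4 -> clique Q ->
  4 <= #|[set S : {set V} | (#|S| == 4) && triangle_isolated S]|.
Proof.
move=> /eqP; rewrite cards_eq0 => /eqP nz Q4 cQ.
have zx x : g z x = false by have := in_set0 x; rewrite -nz inE.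
have zQ : z \notin Q.
  by apply/negP => zQ; have := degin_clique cQ zQ; rewrite /degin nz setI0 cards0 Q4.
have inj : {in Q &, injective (fun y => z |: (Q :\ y))}.
  move=> y y' yQ y'Q e; apply: contraTeq isT => neq.
  have : y \notin z |: (Q :\ y).
    by rewrite !inE eqxx orbF; apply: contraNneq zQ => <-.
  by rewrite e !inE neq yQ orbT.
rewrite -{1}Q4 -(card_in_imset inj); apply: subset_leq_card; apply/subsetP => _ /imsetP [y yQ ->].
have cQy : #|Q :\ y| = 3 by have := cardsD1 y Q; rewrite yQ Q4 => -[].
have zQy : z \notin Q :\ y by rewrite in_setD1 (negbTE zQ) andbF.
have dz : degin g (z |: (Q :\ y)) z = 0 by rewrite /degin nz setI0 cards0.
have cQ' : clique (Q :\ y).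
  by move=> a b; rewrite !in_setD1 => /andP [_ aQ] /andP [_ bQ]; apply: cQ.
rewrite inE cardsU1 zQy cQy /= /triangle_isolated; apply/andP; split.
  rewrite /vol big_setU1 //= dz add0n (eq_bigr (fun=> 2)) => [|x xQ].
    by rewrite sum_nat_const cQy.
  by rewrite deginU1 ?degin_clique ?cQy // sym zx.
by apply/card_gt0P; exists z; rewrite in_set setU11 dz.
Qed.

(** A triangle contains no leaf, so it lies in [Q]; the isolated vertex [x] of the card is then a
    leaf outside [Q], and the triangle must be [Q] without the neighbour of [x]. Thus [x] determines
    the card. *)
Lemma few_triangle_isolated Q : #|Q| = 4 -> clique Q ->
  (forall x, x \notin Q -> deg g x = 1 /\ exists2 y, y \in Q & g x y) ->
  #|[set S : {set V} | (#|S| == 4) && triangle_isolated S]| <= #|~: Q|.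
Proof.
move=> Q4 cQ leaf; pose f x := odflt x [pick y in Q | g x y].
apply: leq_trans (leq_imset_card (fun x => x |: (Q :\ f x)) _).
apply: subset_leq_card; apply/subsetP => S; rewrite inE => /andP [/eqP S4 /andP [/eqP vS]].
case/card_gt0P => x; rewrite inE => /andP [xS /eqP dx].
have nx y : y \in S -> ~~ g x y.
  move=> yS; apply/negP => xy; have : 0 < degin g S x by apply/card_gt0P; exists y; rewrite !inE yS.
  by rewrite dx.
have cA : #|S :\ x| = 3 by have := cardsD1 x S; rewrite xS S4 => -[].
have dA y : y \in S :\ x -> degin g S y = degin g (S :\ x) y.
  by rewrite in_setD1 => /andP [_ yS]; rewrite -{1}(setD1K xS) deginU1 // sym nx.
have vA : vol g (S :\ x) = 6.
  by rewrite -vS [in RHS]/vol (big_setD1 x) //= dx add0n; apply/esym/eq_bigr.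
have AQ : S :\ x \subset Q.
  apply/subsetP => y yA; apply: contraT => yQ; have [dy _] := leaf y yQ.
  have d2 : degin g (S :\ x) y = 2.
    by apply: (vol_tight (m := 2)) => // z zA; rewrite -ltnS -cA; apply: degin_lt.
  by have := degin_split (S :\ x) y; rewrite dy d2.
have [y yA] : exists y, y \in S :\ x by apply/card_gt0P; rewrite cA.
have xQ : x \notin Q.
  apply/negP => xQ; have := yA; rewrite in_setD1 => /andP [yx yS].
  by have := nx y yS; rewrite cQ // ?(subsetP AQ) // eq_sym.
have [_ [y0 y0Q xy0]] := leaf x xQ.
have [fQ xf] : f x \in Q /\ g x (f x).
  rewrite /f; case: pickP => [y1 /andP [] //|/(_ y0)]; by rewrite y0Q xy0.
apply/imsetP; exists x; first by rewrite inE.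
rewrite -{1}(setD1K xS); congr (_ |: _); apply/eqP; rewrite eqEcard cA.
have := cardsD1 (f x) Q; rewrite fQ Q4 add1n => -[<-]; rewrite andbT.
apply/subsetP => z zA; rewrite in_setD1 (subsetP AQ) // andbT.
by apply: contraTneq xf => <-; apply: nx; move: zA; rewrite in_setD1 => /andP [].
Qed.

(** Count edges between the leaves [L] and the vertices [F] of degree 4. With [Q] the set of
    non-leaves, each vertex of [F] needs at least 5 - |Q| leaves and each leaf serves at most one
    vertex, which forces |Q| = 4 and |L| = 3. Each vertex of [F] then has exactly one leaf and is
    adjacent to the rest of [Q]; [F] misses at most one vertex of [Q], so [Q] is a clique. *)
Lemma leaves_and_clique : #|V| = 7 -> 3 <= degcount g 1 -> 3 <= degcount g 4 ->
  exists Q, [/\ #|Q| = 4, clique Q &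
    forall x, x \notin Q -> deg g x = 1 /\ exists2 y, y \in Q & g x y].
Proof.
move=> V7 h1 h4; pose L := [set x | deg g x == 1]; pose F := [set x | deg g x == 4].
pose Q := ~: L.
have cL : 3 <= #|L| := h1.
have cF : 3 <= #|F| := h4.
have FQ : F \subset Q by apply/subsetP => x; rewrite !inE => /eqP ->.
have cLQ : #|L| + #|Q| = 7 by rewrite cardsC.
have dL x : x \in L -> degin g Q x <= 1.
  by rewrite inE => /eqP dx; rewrite -dx (degin_split Q x) leq_addr.
have dF x : x \in F -> 5 <= degin g L x + #|Q|.
  move=> xF; have xQ := subsetP FQ x xF; move: xF; rewrite inE (degin_split Q x) setCK.
  have := degin_lt xQ; rewrite addnC; move: (degin _ _ _) (degin _ _ _) #|Q| => p q m; clear; lia.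
have sumL : \sum_(u in Q) degin g L u <= #|L|.
  by rewrite edge_exchange -sum1_card; apply: leq_sum.
have sumF : \sum_(u in F) degin g L u <= #|L|.
  apply: leq_trans sumL; rewrite [X in _ <= X](bigID (mem F)) /=.
  rewrite (eq_bigl (fun u => (u \in Q) && (u \in F))) ?leq_addr // => u.
  by apply/idP/andP => [uF|[]//]; rewrite uF (subsetP FQ).
have sumF' : #|F| * (5 - #|Q|) <= #|L|.
  apply: leq_trans sumF; rewrite -sum_nat_const; apply: leq_sum => u /dF.
  by rewrite leq_subLR addnC.
have Q3 : 3 <= #|Q| by apply: leq_trans cF (subset_leq_card FQ).
have Q4 : #|Q| = 4.
  move: cL cF cLQ sumF' Q3; move: #|L| #|F| #|Q| => l f q; clear => cL cF cLQ sumF' Q3.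
  have [//|q3] : q = 4 \/ q = 3 by lia.
  rewrite q3 in sumF' cLQ; nia.
have L3 : #|L| = 3 by move: cLQ; rewrite Q4; clear; move: #|L| => l; lia.
have dF1 x : x \in F -> 1 <= degin g L x by move/dF; rewrite Q4; clear; lia.
have rest x : x \in F -> degin g L x <= 1.
  move=> xF; have := sumF; rewrite L3 (big_setD1 x) //=.
  have : #|F :\ x| <= \sum_(u in F :\ x) degin g L u.
    by rewrite -sum1_card; apply: leq_sum => u; rewrite in_setD1 => /andP [_]; apply: dF1.
  have := cardsD1 x F; rewrite xF.
  move: cF; move: #|F| #|_ :\ _| (degin _ _ _) (\sum_(_ in _) _) => p q m l; clear; lia.
have adj x y : x \in F -> y \in Q -> x != y -> g x y.
  move=> xF yQ xy; have xQ := subsetP FQ x xF.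
  have d3 : 3 <= degin g Q x.
    have := rest x xF; move: xF; rewrite inE (degin_split Q x) setCK; clear; lia.
  have e : Q :&: nb g x = Q :\ x.
    apply/eqP; rewrite eqEcard; apply/andP; split.
      by apply/subsetP => z; rewrite !inE => /andP [-> xz]; rewrite andbT; apply: contraTneq xz => ->; rewrite irr.
    by have := cardsD1 x Q; rewrite xQ Q4 add1n => -[<-].
  have : y \in Q :\ x by rewrite in_setD1 eq_sym xy.
  by rewrite -e inE => /andP [_]; rewrite inE.
have QF1 : #|Q :\: F| <= 1.
  by rewrite cardsD (setIidPr FQ) Q4; move: cF; clear; move: #|F| => f; lia.
exists Q; split=> //.
  move=> x y xQ yQ xy; have [xF|xF] := boolP (x \in F); first exact: adj.
  have [yF|yF] := boolP (y \in F); first by rewrite sym adj // eq_sym.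
  have : [set x; y] \subset Q :\: F by rewrite subUset !sub1set !in_setD xF yF xQ yQ.
  by move/subset_leq_card; rewrite cards2 xy => /leq_trans /(_ QF1).
move=> x; rewrite in_setC negbK => xL; split; first by apply/eqP; move: xL; rewrite inE.
have : 3 <= \sum_(v in L) degin g Q v.
  rewrite -edge_exchange; apply: leq_trans cF _; rewrite -sum1_card.
  rewrite [X in _ <= X](bigID (mem F)) /=; apply: leq_trans (leq_addr _ _).
  rewrite [X in _ <= X](eq_bigl (mem F)) => [|u]; first by apply: leq_sum => u; apply: dF1.
  by rewrite /= andbC; case uF: (u \in F) => //=; rewrite (subsetP FQ).
rewrite (big_setD1 x) //=.
have : \sum_(v in L :\ x) degin g Q v <= #|L :\ x|.
  by rewrite -sum1_card; apply: leq_sum => u; rewrite in_setD1 => /andP [_]; apply: dL.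
have := cardsD1 x L; rewrite xL L3 add1n => -[<-] le le'.
have /card_gt0P [y] : 0 < degin g Q x.
  by move: le le'; move: (degin _ _ _) (\sum_(_ in _) _) => p q; clear; lia.
by rewrite !inE => /andP [yQ xy]; exists y; rewrite // !inE.
Qed.

End SevenVertices.

(** * Connectedness passes between graphs with equal decks *)

Lemma triangle_isolated_iso (V W : finType) (g : rel V) (h : rel W) S T :
  card_iso g h S T -> triangle_isolated g S = triangle_isolated h T.
Proof.
by move=> iso; rewrite /triangle_isolated (vol_iso iso) (degin_count_iso iso).
Qed.

Lemma connected_transfer n (G H : rel 'I_n) : 7 <= n -> simple_graph G -> simple_graph H ->
  same_deck (n - 3) G H -> connected_graph G -> connected_graph H.
Proof.
move=> n7 sG sH GH cG x0 y0; apply: contraT => nxy; exfalso.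
have ncon : ~ (forall x y, connect H x y) by move=> c; rewrite c in nxy.
have [irrG symG] := sG; have [irrH symH] := sH.
have [d0|d0] := posnP (degcount H 0); last first.
  have [z] := card_gt0P d0; rewrite inE => /eqP dz.
  have sumG : \sum_(i < n) degcount G i = n by have := sum_degcount irrG; rewrite card_ord.
  have sumH : \sum_(i < n) degcount H i = n by have := sum_degcount irrH; rewrite card_ord.
  have eqm e : e + 3 <= n.-1 -> moment n.-1 (degcount H) e = moment n.-1 (degcount G) e.
    by move=> en; rewrite (deck_degcount n7 sG sH GH).
  have g0 := connected_no_isolated n7 cG.
  have hN : degcount H n.-1 = 0.
    apply/eqP; rewrite cards_eq0; apply/eqP/setP => x; rewrite !inE; apply/negbTE/negP => /eqP dx.
    have xz : x != z by apply: contra_eq_neq dx => ->; rewrite dz; lia.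
    have : nb H x \subset ~: [set x; z].
      apply/subsetP => y; rewrite !inE => xy; rewrite negb_or; apply/andP; split.
        by apply: contraTneq xy => ->; rewrite irrH.
      apply: contraTneq xy => ->; rewrite symH.
      by move/eqP: dz; rewrite cards_eq0 => /eqP /setP /(_ x); rewrite !inE => ->.
    move/subset_leq_card; rewrite -/(deg H x) dx cardsCs setCK card_ord cards2 xz; lia.
  have [n8|n8] := ltnP 7 n.
    exact: (isolated_counts_false n8 sumH sumG eqm d0 g0 hN).
  have e7 : n = 7 by apply/eqP; rewrite eqn_leq n8.
  subst n.
  have [h1 h4] := isolated_counts7 sumH sumG eqm d0 g0 hN.
  have [Q [Q4 cQ leaf]] := leaves_and_clique irrG symG (card_ord 7) h1 h4.
  (* Volume 12 on four vertices means K4, so [H] also contains one. With its isolated vertex, [H]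
     has at least four cards consisting of a triangle and an isolated vertex, while [G] has at most
     three. *)
  have := deck_pred sG sH GH (P := fun S => vol G S == 12) (Q := fun S => vol H S == 12).
  move=> /(_ (fun S T iso => congr1 (fun v => v == 12) (vol_iso iso))) eK4.
  have [Q' /andP [/eqP Q'4 /eqP vQ']] : exists S : {set 'I_7}, (#|S| == 4) && (vol H S == 12).
    have : 0 < #|[set S : {set 'I_7} | (#|S| == 7 - 3) && (vol H S == 12)]|.
      by rewrite -eK4; apply/card_gt0P; exists Q; rewrite inE Q4 (vol_clique4 irrG Q4 cQ).
    by case/card_gt0P => S; rewrite inE; exists S.
  have many := many_triangle_isolated irrH symH dz Q'4 (clique_vol4 irrH Q'4 vQ').
  have few := few_triangle_isolated irrG symG Q4 cQ leaf.
  have := deck_pred sG sH GH (@triangle_isolated_iso _ _ G H).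
  move=> e; have := leq_trans many (eq_leq (esym e)) => /leq_trans /(_ few).
  by rewrite cardsCs setCK Q4 card_ord.
have two := deck_two_conn n7 sG sH GH cG.
have [|||[z dz]|[C [b1 [b2 [cC connC Cc Hb clC]]]]] := disconnected_structure irrH symH.
- by rewrite card_ord.
- exact: ncon.
- by rewrite card_ord.
- by have : 0 < degcount H 0 by [apply/card_gt0P; exists z; rewrite inE dz]; rewrite d0.
rewrite card_ord in cC.
have le := conn_count_component n7 cC clC.
have leaves := degcount_leaves n7 sG sH GH cG cC connC Cc Hb clC d0.
have [w dw] := exists_large_degree n7 sG sH GH cG cC connC Cc Hb clC d0.
have : n - 1 <= #|good G|.
  case: dw => dw.
    have := many_conn_codeg2 irrG symG cG (w := w); rewrite card_ord; exact.
  have := many_conn_codeg3 irrG symG cG (w := w); rewrite card_ord; exact.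
rewrite card_good ?card_ord; last by lia.
rewrite (deck_conn sG sH GH) => /leq_trans /(_ le); lia.
Qed.

Theorem theorem1p5 :
  (forall (n : nat), 7 <= n ->
     forall G H : rel 'I_n, simple_graph G -> simple_graph H ->
       same_deck (n - 3) G H ->
       (connected_graph G <-> connected_graph H))
  /\
  (exists G H : rel 'I_6,
     [/\ simple_graph G, simple_graph H, same_deck 3 G H,
         connected_graph G & ~ connected_graph H]).
Proof.
split; last exact: sharp_threshold.
move=> n n7 G H sG sH GH; split; first exact: connected_transfer GH.
by apply: connected_transfer => // F sF; rewrite GH.
Qed.
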